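(* Let $V=\mathbb{R}^2(x,y)$ with symplectic form $\omega=dx\wedge dy$, and let the affine conformal symplectic group $H=\mathrm{ACSp}(2,\mathbb{R})=\mathrm{CSp}(2,\mathbb{R})\ltimes\mathbb{R}^2$, where $\mathrm{CSp}(2,\mathbb{R})=\mathrm{Sp}(2,\mathbb{R})\times\mathbb{R}_+$, act on $V$ by affine transformations. For curves $y=y(x)$ put $$I'_4=\sqrt[3]{y_2}\,(3y_2^{-2}y_4-5y_2^{-3}y_3^2),\quad I''_4=(I'_4)^3,\quad \nabla''=\frac{I'_4}{\sqrt[3]{y_2}}\mathcal{D}_x,$$ $$I_5=\frac{(\nabla''I''_4)^2}{(I''_4)^3},\qquad \nabla'''=\frac{I''_4}{\nabla''(I''_4)}\nabla'' .$$ Then the algebra of differential invariants of the $H$-action on the space $J^\infty(V,1)$ of infinite jets of curves in $V$ is the free differential algebra $\mathcal{A}_H=\langle I_5\,;\,\nabla'''\rangle$.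
   Context: $J^k(V,1)$ is the space of $k$-jets of unparametrized curves in $V$, with coordinates $x,y,y_1,\dots,y_k$ on the chart of graphs $y=y(x)$, where $y_l$ is the $l$-th derivative; $\mathcal{D}_x$ is the total derivative. $H$ acts on $J^k(V,1)$ by prolongation. A differential invariant of order $k$ is a function on $J^k(V,1)$ constant on orbits of the prolonged action; differential invariants are taken to be rational functions of the jet-variables (and may be chosen polynomial in jet-variables of sufficiently high order). $\mathcal{A}_H$ is the algebra of all differential invariants. An invariant derivation is a derivation $f\mathcal{D}_x$, $f$ a function on a finite jet space, commuting with the prolonged action. 'Free differential algebra $\langle I;\nabla\rangle$' means: every element of the algebra is a rational expression in finitely many of the functions $\nabla^jI$, $j\ge0$, and these functions are algebraically independent (no differential syzygies). *)

(* Defs.v *)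
From HB Require Import structures.
From mathcomp Require Import all_boot all_order all_algebra.
From mathcomp Require Import fraction generic_quotient.
From mathcomp Require Import mpoly ring.
From mathcomp Require Import boolp classical_sets functions reals topology.
From mathcomp Require Import normedtype derive exp.

Set Implicit Arguments.
Unset Strict Implicit.
Unset Printing Implicit Defensive.

Import Order.TTheory GRing.Theory Num.Theory.
Import numFieldNormedType.Exports.

Local Open Scope classical_set_scope.
Local Open Scope ring_scope.

Section Group.
Context {R : realType}.

Definition plane := 'cV[R]_2.

Definition pt (x y : R) : plane := \col_i (if i == 0 then x else y).

Definition xcoord (v : plane) : R := v 0 0.
Definition ycoord (v : plane) : R := v 1 0.

(* omega = dx /\ dy *)
Definition omega (u v : plane) : R :=
  xcoord u * ycoord v - ycoord u * xcoord v.

Definition Sp2 : set 'M[R]_2 :=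
  [set S | forall u v, omega (S *m u) (S *m v) = omega u v].

(* The factor R_+ acts by homotheties. *)
Definition CSp2 : set 'M[R]_2 :=
  [set A | exists S lambda, [/\ Sp2 S, 0 < lambda & A = lambda *: S]].

Definition ACSp2 : set (plane -> plane) :=
  [set g | exists A b, CSp2 A /\ g = (fun v => A *m v + b)].

End Group.

(* A point of J^oo(V,1) in the chart of graphs y = y(x) is a sequence          *)
(* theta : nat -> R, with theta 0 = x and theta l.+1 = y_l (where y_0 = y);    *)
(* its image in J^k(V,1) consists of the entries of index < k.+2.              *)
Section Jets.
Context {R : realType}.

Definition jetpt := nat -> R.

Definition smooth_near (phi : R -> R) (x : R) : Prop :=
  \forall t \near x, forall n, derivable (derive1n n phi) t 1.

Definition jet (phi : R -> R) (x : R) : jetpt :=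
  fun i => if i is l.+1 then derive1n l phi x else x.

Definition graph (phi : R -> R) : set plane :=
  [set v | ycoord v = phi (xcoord v)].

(* [prolongs g theta theta']: the prolongation of g maps the jet theta to the  *)
(* jet theta', i.e. theta is the jet of a curve C at a point a and theta' is   *)
(* the jet of g(C) at g(a). Nothing is asserted about jets that g carries out  *)
(* of the chart.                                                               *)
Definition prolongs (g : plane -> plane) (theta theta' : jetpt) : Prop :=
  exists phi psi : R -> R,
    [/\ smooth_near phi (theta 0%N) /\ jet phi (theta 0%N) = theta,
        smooth_near psi (theta' 0%N) /\ jet psi (theta' 0%N) = theta',
        g (pt (theta 0%N) (theta 1%N)) = pt (theta' 0%N) (theta' 1%N)
      & \forall t \near theta 0%N, graph psi (g (pt t (phi t)))].

End Jets.

(* Rational functions of the jet variables. In {mpoly R[k.+2]} the variable    *)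
(* 'X_0 is x and 'X_(l.+1) is y_l, for l <= k.                                 *)
Section RationalFunctions.
Context {R : realType}.

Definition jetrat (k : nat) := {fraction {mpoly R[k.+2]}}.

(* Extension to fields of fractions of an injective ring morphism *)
Definition fracmap (A B : idomainType) (h : A -> B) (f : {fraction A}) :
    {fraction B} :=
  FracField.tofrac (h (frac (repr f)).1) / FracField.tofrac (h (frac (repr f)).2).

(* Pull-back along J^m -> J^k; only used for k <= m. *)
Definition embpoly (k m : nat) (p : {mpoly R[k.+2]}) : {mpoly R[m.+2]} :=
  p \mPo [tuple 'X_(inord (val i)) | i < k.+2].

Definition emb (k m : nat) : jetrat k -> jetrat m := fracmap (@embpoly k m).

(* Total derivative D_x = d/dx + \sum_l y_(l+1) d/dy_l *)
Definition Dpoly (k : nat) (p : {mpoly R[k.+2]}) : {mpoly R[k.+3]} :=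
  embpoly k.+1 p^`M(ord0) +
  \sum_(l < k.+1) 'X_(lift ord0 (lift ord0 l)) *
                  embpoly k.+1 p^`M(lift ord0 l).

Definition Dx (k : nat) (f : jetrat k) : jetrat k.+1 :=
  let n := (frac (repr f)).1 in
  let d := (frac (repr f)).2 in
  FracField.tofrac (Dpoly n * embpoly k.+1 d - embpoly k.+1 n * Dpoly d)
  / FracField.tofrac (embpoly k.+1 d ^+ 2).

(* A rational function on some finite jet space. *)
Record jetfun := Jetfun { jorder : nat; jfun : jetrat jorder }.

Definition jat (m : nat) (f : jetfun) : jetrat m := emb m (jfun f).

Definition jop2 (op : forall k, jetrat k -> jetrat k -> jetrat k)
    (f g : jetfun) : jetfun :=
  let m := maxn (jorder f) (jorder g) in Jetfun (op m (jat m f) (jat m g)).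

Definition jmul : jetfun -> jetfun -> jetfun := jop2 (fun k f g => f * g).
Definition jdiv : jetfun -> jetfun -> jetfun := jop2 (fun k f g => f / g).
Definition jexp (f : jetfun) (n : nat) : jetfun := Jetfun (jfun f ^+ n).

Definition jetderivation (c : jetfun) (f : jetfun) : jetfun :=
  jmul c (Jetfun (Dx (jfun f))).

(* The rational function f is defined at theta and takes there the value v. *)
Definition jval (f : jetfun) (theta : jetpt) (v : R) : Prop :=
  exists n d : {mpoly R[(jorder f).+2]},
    let ev (p : {mpoly R[(jorder f).+2]}) := p.@[fun i => theta (val i)] in
    [/\ jfun f = FracField.tofrac n / FracField.tofrac d,
        ev d != 0 & v = ev n / ev d].

End RationalFunctions.
Arguments jetrat : clear implicits.
Arguments jetfun : clear implicits.

Section Invariants.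
Context {R : realType}.

(* h = g^* f, i.e. h = f \o g^(oo) wherever both sides are defined *)
Definition is_pullback (g : @plane R -> @plane R) (f h : jetfun R) : Prop :=
  forall theta theta' v v',
    prolongs g theta theta' -> jval h theta v -> jval f theta' v' -> v = v'.

Definition diff_invariant (H : set (@plane R -> @plane R)) (f : jetfun R) :
    Prop :=
  forall g, H g -> is_pullback g f f.

(* f D_x commutes with the prolonged action: the operator maps g^* f to the    *)
(* pull-back by g of its value on f.                                           *)
Definition invariant_derivation (H : set (@plane R -> @plane R))
    (nabla : jetfun R -> jetfun R) : Prop :=
  (exists c, nabla = jetderivation c) /\
  forall g, H g ->
  forall f h, is_pullback g f h -> is_pullback g (nabla f) (nabla h).

Definition nablaI (I : jetfun R) (nabla : jetfun R -> jetfun R) (j : nat) :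
    jetfun R :=
  iter j nabla I.

(* P (I, nabla I, ..., nabla^(N-1) I) as an element of R(J^m); only used when  *)
(* these N functions have order at most m.                                     *)
Definition evalnabla (I : jetfun R) (nabla : jetfun R -> jetfun R)
    (m N : nat) (P : {mpoly R[N]}) : jetrat R m :=
  mmap (fun c => FracField.tofrac (c%:MP_[m.+2]))
       (fun j : 'I_N => jat m (nablaI I nabla j)) P.

Definition nabla_order_le (I : jetfun R) (nabla : jetfun R -> jetfun R)
    (m N : nat) : Prop :=
  forall j, (j < N)%N -> (jorder (nablaI I nabla j) <= m)%N.

(* f is a rational expression in I, nabla I, ..., nabla^(N-1) I for some N *)
Definition rationally_generated (I : jetfun R)
    (nabla : jetfun R -> jetfun R) (f : jetfun R) : Prop :=
  exists N (P Q : {mpoly R[N]}) m,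
    [/\ (jorder f <= m)%N, nabla_order_le I nabla m N,
        evalnabla I nabla m Q != 0
      & jat m f = evalnabla I nabla m P / evalnabla I nabla m Q].

Definition no_syzygies (I : jetfun R) (nabla : jetfun R -> jetfun R) : Prop :=
  forall N (P : {mpoly R[N]}) m,
    nabla_order_le I nabla m N -> evalnabla I nabla m P = 0 -> P = 0.

(* A = < I ; nabla > *)
Definition is_free_diff_algebra (A : set (jetfun R)) (I : jetfun R)
    (nabla : jetfun R -> jetfun R) : Prop :=
  (forall f, A f <-> rationally_generated I nabla f) /\ no_syzygies I nabla.

End Invariants.

Section AffineInvariants.
Context {R : realType}.

(* The real cube root, odd in a; powR is only meaningful on nonnegative reals. *)
Definition cbrt (a : R) : R := Num.sg a * powR `|a| 3^-1.

Lemma cbrtK (a : R) : cbrt a ^+ 3 = a.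
Proof.
have -> : cbrt a ^+ 3 = Num.sg a ^+ 3 * `|a|.
  rewrite exprMn; congr (_ * _).
  by rewrite -powR_mulrn ?powR_ge0// -powRrM mulVf ?pnatr_eq0// powRr1.
rewrite exprS sqr_sg.
have [->|a0] := eqVneq a 0; first by rewrite normr0 mulr0.
by rewrite mulr1 -numEsg.
Qed.

(* I'_4 as a function of the jet theta = (x, y, y_1, y_2, y_3, y_4, ...); it   *)
(* is not a rational function.                                                 *)
Definition I4'_val (theta : jetpt) : R :=
  let y2 := theta 3%N in let y3 := theta 4%N in let y4 := theta 5%N in
  cbrt y2 * (3 * y2 ^- 2 * y4 - 5 * y2 ^- 3 * y3 ^+ 2).

(* y_l as a function on J^k, for l <= k *)
Definition yvar (k l : nat) : jetrat R k :=
  FracField.tofrac 'X_(inord l.+1).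

(* I'_4 / y_2^(1/3), the coefficient of nabla'', with the cube roots           *)
(* cancelled; see coef''_val.                                                  *)
Definition coef'' : jetfun R :=
  let y2 := yvar 4 2 in let y3 := yvar 4 3 in let y4 := yvar 4 4 in
  Jetfun (3 * y2 ^- 2 * y4 - 5 * y2 ^- 3 * y3 ^+ 2).

(* I''_4 = (I'_4)^3; see I4''_val. *)
Definition I4'' : jetfun R :=
  let y2 := yvar 4 2 in let y3 := yvar 4 3 in let y4 := yvar 4 4 in
  Jetfun (y2 * (3 * y2 ^- 2 * y4 - 5 * y2 ^- 3 * y3 ^+ 2) ^+ 3).

Local Notation num4 := (3 * 'X_(inord 3) * 'X_(inord 5) - 5 * 'X_(inord 4) ^+ 2
  : {mpoly R[6]}).
Local Notation den4 := ('X_(inord 3) ^+ 3 : {mpoly R[6]}).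

Lemma tofrac_num4 (A : idomainType) (a b c : A) (F := @FracField.tofrac A) :
  F a != 0 ->
  3 * F a ^- 2 * F c - 5 * F a ^- 3 * F b ^+ 2
  = F (3 * a * c - 5 * b ^+ 2) / F (a ^+ 3).
Proof.
rewrite /F => a0; rewrite !(tofracB, tofracM, tofracXn) !rmorph_nat.
move: (FracField.tofrac a) a0 (FracField.tofrac b) (FracField.tofrac c).
move=> u u0 v w.
by field.
Qed.

Lemma coef''_frac :
  jfun coef'' = FracField.tofrac num4 / FracField.tofrac den4.
Proof.
have X0 : FracField.tofrac ('X_(inord 3) : {mpoly R[6]}) != 0.
  rewrite tofrac_eq0; apply/eqP => /(congr1 (meval (fun=> 1 : R))).
  by rewrite mevalXU meval0 => /eqP; rewrite oner_eq0.
exact: tofrac_num4.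
Qed.

Lemma coef''_val (theta : jetpt) : theta 3%N != 0 ->
  jval coef'' theta (I4'_val theta / cbrt (theta 3%N)).
Proof.
move=> y0; have c0 : cbrt (theta 3%N) != 0.
  by apply: contra_neq y0 => c0; rewrite -[LHS]cbrtK c0 expr0n.
exists num4, den4; split; first exact: coef''_frac.
  by rewrite rmorphXn /= mevalXU inordK// expf_neq0.
rewrite !(rmorphXn, rmorphB, rmorphM, rmorph_nat) /= !mevalXU !inordK// /I4'_val.
by field; rewrite y0 c0.
Qed.

Lemma I4''_val (theta : jetpt) : theta 3%N != 0 ->
  jval I4'' theta (I4'_val theta ^+ 3).
Proof.
move=> y0; exists ('X_(inord 3) * num4 ^+ 3), (den4 ^+ 3); split.
- rewrite tofracM !tofracXn -mulrA -expr_div_n -tofracXn.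
  by rewrite -coef''_frac.
- by rewrite !rmorphXn /= mevalXU inordK// !expf_neq0.
rewrite !(rmorphXn, rmorphB, rmorphM, rmorph_nat) /=.
rewrite !mevalXU !inordK// /I4'_val exprMn cbrtK.
by field; rewrite y0.
Qed.

Definition nabla'' : jetfun R -> jetfun R := jetderivation coef''.

Definition I5 : jetfun R := jdiv (jexp (nabla'' I4'') 2) (jexp I4'' 3).

(* (I''_4 / nabla''(I''_4)) nabla'', written through its coefficient of D_x *)
Definition nabla''' : jetfun R -> jetfun R :=
  jetderivation (jmul (jdiv I4'' (nabla'' I4'')) coef'').

End AffineInvariants.

(* Main.v *)
(* Write N = 3 y_2 y_4 - 5 y_3^2 and M = 3 y_2 D_x N - 8 y_3 N. An affine map with
   linear part A multiplies y_2, N and M by det A / delta^3, (det A)^2 / delta^8 and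
   (det A)^3 / delta^12, where delta = D_x x'. Since I_5 = M^2 / N^3 and nabla''' =
   (y_2 N / M) D_x, the function I_5 and the derivation nabla''' are invariant.

   For l >= 1 the invariant J_l = nabla'''^l I_5 is affine in its highest variable
   y_(5+l), with a nonvanishing coefficient of order at most 5. On the slice of jets
   (0, 0, 0, 1, 0, tau, tau, y_6, y_7, ...) one has J_0 = 3 / tau, so J_0, J_1, ...
   are rational coordinates there: they take arbitrary values with J_0 <> 0, whence
   there are no syzygies. Every jet with y_2 <> 0 and M N > 0 is carried into the
   slice by an element of the group, so an invariant is determined by its restriction
   to the slice, a rational function of the J_l. As the denominator of an invariant
   may vanish on the slice, a fixed group element is first applied to the slice.

   Identities between rational functions are checked pointwise on a nonempty open set
   and extended to all jets by restriction to lines. *)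
Require Import Defs.
From mathcomp Require Import all_boot all_order all_algebra.
From mathcomp Require Import fraction generic_quotient.
From mathcomp Require Import mpoly ring.
From mathcomp Require Import boolp classical_sets functions reals topology.
From mathcomp Require Import normedtype derive realfun.

Set Implicit Arguments.
Unset Strict Implicit.
Unset Printing Implicit Defensive.

Import Order.TTheory GRing.Theory Num.Theory.
Import numFieldNormedType.Exports.

Local Open Scope classical_set_scope.
Local Open Scope ring_scope.

(** * Polynomials vanishing at every point *)

(** Induction on the number of variables. With the first n variables specialised to [v], the
    polynomial becomes a univariate [Q] in the last one, with a root at every integer. In
    characteristic 0 it is zero, so each coefficient [P k] vanishes at [v]. *)
Lemma mpoly_meval_eq0 (R : numDomainType) n (p : {mpoly R[n]}) :
  (forall v, p.@[v] = 0) -> p = 0.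
Proof.
elim: n p => [|n IHn] p pv; apply/mpolyP => m; rewrite mcoeff0.
  apply/eqP; rewrite -[p@_m]mulr1; apply/eqP; rewrite -[RHS](pv (fun=> 0)) mevalE.
  have m0 (m' : 'X_{1..0}) : m' = m by apply/mnmP => -[].
  have [mp|mp] := boolP (m \in msupp p).
    rewrite (bigD1_seq m)//= big_ord0 big1 ?addr0// => m' /eqP [].
    exact: m0.
  rewrite (memN_msupp_eq0 mp) mul0r big1_seq// => m' /andP[_].
  by rewrite (m0 m') (negbTE mp).
pose W : 'I_n -> 'I_n.+1 := widen_ord (leqnSn n).
pose r (m' : 'X_{1..n.+1}) := [multinom m' (W i) | i < n].
have rI m1 m2 : r m1 = r m2 -> m1 ord_max = m2 ord_max -> m1 = m2.
  move=> /mnmP r12 e; apply/mnmP => i.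
  have [->//|im] := eqVneq i ord_max.
  have il : (i < n)%N.
    by move: im; rewrite -val_eqE/= => im; rewrite ltn_neqAle im -ltnS ltn_ord.
  have := r12 (Ordinal il); rewrite !mnmE.
  by have -> : W (Ordinal il) = i by apply/val_inj.
pose P k := \sum_(m' <- msupp p | m' ord_max == k) p@_m' *: 'X_[r m'].
have P0 k : P k = 0.
  apply: IHn => v.
  pose Q : {poly R} := \sum_(m' <- msupp p)
    (p@_m' * \prod_(i < n) v i ^+ m' (W i)) *: 'X^(m' ord_max).
  have Q0 : Q = 0.
    apply: (roots_geq_poly_eq0 (rs := [seq i%:R | i <- iota 0 (size Q)])).
    - apply/allP => t _; apply/rootP; rewrite /Q horner_sum.
      pose vt (i : 'I_n.+1) := if insub (val i) is Some j then v j else t.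
      rewrite -[RHS](pv vt) mevalE; apply: eq_bigr => m' _.
      rewrite hornerZ hornerXn big_ord_recr/= mulrA; congr (_ * _ * _ ^+ _).
        apply: eq_bigr => i _; rewrite /vt/=; case: insubP => [j _ /= /val_inj <-//|].
        by rewrite ltn_ord.
      by rewrite /vt/= insubF// ltnn.
    - by rewrite map_inj_uniq ?iota_uniq//; exact: mulrIn (oner_neq0 _).
    - by rewrite size_map size_iota.
  transitivity Q`_k; last by rewrite Q0 coef0.
  rewrite /P /Q coef_sum raddf_sum/= [LHS]big_mkcond/=; apply: eq_bigr => m' _.
  rewrite coefZ coefXn eq_sym; case: eqVneq => _; last by rewrite mulr0.
  rewrite mevalZ mevalX mulr1; congr (_ * _).
  by apply: eq_bigr => i _; rewrite mnmE.
have [mp|/memN_msupp_eq0//] := boolP (m \in msupp p).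
have := congr1 (fun q : {mpoly R[n]} => q@_(r m)) (P0 (m ord_max)).
rewrite mcoeff0 raddf_sum/= big_mkcond (bigD1_seq m)//= eqxx.
rewrite mcoeffZ mcoeffX eqxx mulr1 big1 ?addr0// => m' mm.
case: eqP => // e; rewrite mcoeffZ mcoeffX.
case: eqP => [re|]; last by rewrite mulr0.
by rewrite (rI _ _ re e) eqxx in mm.
Qed.

Lemma mpoly_neq0_meval (R : numDomainType) n (p : {mpoly R[n]}) :
  p != 0 -> exists v, p.@[v] != 0.
Proof.
move=> p0; apply: contrapT => /forallNP nv; move/eqP: p0; apply.
by apply: mpoly_meval_eq0 => v; apply/eqP; have /negP/negPn := nv v.
Qed.

(** * Rational expressions in the jet variables *)

(** A syntax for rational functions on which differentiation, substitution and a domain of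
    definition are computed structurally, without choosing fractions. *)
Inductive jexpr (R : Type) : Type :=
| Cst of R
| Var of nat
| Add of jexpr R & jexpr R
| Mul of jexpr R & jexpr R
| Inv of jexpr R.
Arguments Var {R}.

Notation "x \+e y" := (Add x y) (at level 50, left associativity).
Notation "x \*e y" := (Mul x y) (at level 40, left associativity).

Section Expressions.
Variable R : realType.
Implicit Types (e : jexpr R) (theta : nat -> R) (s : nat -> jexpr R).

Fixpoint evale e theta : R :=
  match e with
  | Cst c => c
  | Var i => theta i
  | Add e1 e2 => evale e1 theta + evale e2 theta
  | Mul e1 e2 => evale e1 theta * evale e2 theta
  | Inv e1 => (evale e1 theta)^-1
  end.

(** A syntactic domain, possibly smaller than that of the function denoted. It also encodes open
    conditions: [Inv e] is defined where [e] is defined and nonzero, and a sum on the intersection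
    of the two domains. *)
Fixpoint defd e theta : bool :=
  match e with
  | Cst _ | Var _ => true
  | Add e1 e2 | Mul e1 e2 => defd e1 theta && defd e2 theta
  | Inv e1 => defd e1 theta && (evale e1 theta != 0)
  end.

Fixpoint vbound n e : bool :=
  match e with
  | Cst _ => true
  | Var i => (i < n)%N
  | Add e1 e2 | Mul e1 e2 => vbound n e1 && vbound n e2
  | Inv e1 => vbound n e1
  end.

Fixpoint subst e s : jexpr R :=
  match e with
  | Cst c => Cst c
  | Var i => s i
  | Add e1 e2 => Add (subst e1 s) (subst e2 s)
  | Mul e1 e2 => Mul (subst e1 s) (subst e2 s)
  | Inv e1 => Inv (subst e1 s)
  end.

(* The total derivative; Var 0 is x and Var l.+1 is y_l. *)
Fixpoint De e : jexpr R :=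
  match e with
  | Cst _ => Cst 0
  | Var i => if i is l.+1 then Var l.+2 else Cst 1
  | Add e1 e2 => Add (De e1) (De e2)
  | Mul e1 e2 => Add (Mul (De e1) e2) (Mul e1 (De e2))
  | Inv e1 => Mul (Mul (Cst (-1)) (De e1)) (Mul (Inv e1) (Inv e1))
  end.

Lemma vbound_le n m e : (n <= m)%N -> vbound n e -> vbound m e.
Proof.
move=> nm; elim: e => //= [i|e1 IH1 e2 IH2|e1 IH1 e2 IH2].
- by move=> /leq_trans; apply.
- by move=> /andP[/IH1-> /IH2->].
- by move=> /andP[/IH1-> /IH2->].
Qed.

Lemma vbound_De n e : (0 < n)%N -> vbound n e -> vbound n.+1 (De e).
Proof.
move=> n0; elim: e => //= [[|i]//|e1 IH1 e2 IH2|e1 IH1 e2 IH2|e1 IH1].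
- by move=> /andP[/IH1-> /IH2->].
- move=> /andP[v1 v2]; rewrite IH1// IH2//=.
  by rewrite (vbound_le _ v1)// (vbound_le _ v2).
- by move=> v1; rewrite IH1// (vbound_le _ v1).
Qed.

Lemma eq_evale n e theta theta' : vbound n e ->
  (forall i, (i < n)%N -> theta i = theta' i) -> evale e theta = evale e theta'.
Proof.
move=> + E; elim: e => //= [e1 IH1 e2 IH2|e1 IH1 e2 IH2|e1 IH1].
- by move=> /andP[/IH1-> /IH2->].
- by move=> /andP[/IH1-> /IH2->].
- by move=> /IH1->.
Qed.

Lemma eq_defd n e theta theta' : vbound n e ->
  (forall i, (i < n)%N -> theta i = theta' i) -> defd e theta = defd e theta'.
Proof.
move=> + E; elim: e => //= [e1 IH1 e2 IH2|e1 IH1 e2 IH2|e1 IH1].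
- by move=> /andP[/IH1-> /IH2->].
- by move=> /andP[/IH1-> /IH2->].
- by move=> v1; rewrite IH1// (eq_evale v1 E).
Qed.

Lemma evale_subst e s theta :
  evale (subst e s) theta = evale e (fun i => evale (s i) theta).
Proof.
by elim: e => //= [e1 -> e2 ->|e1 -> e2 ->|e1 ->].
Qed.

Lemma defd_subst e s theta :
  defd (subst e s) theta -> defd e (fun i => evale (s i) theta).
Proof.
elim: e => //= [e1 IH1 e2 IH2|e1 IH1 e2 IH2|e1 IH1] /andP[].
- by move=> /IH1-> /IH2->.
- by move=> /IH1-> /IH2->.
- by rewrite evale_subst => /IH1->.
Qed.

Lemma defd_substW n e s theta : vbound n e ->
  (forall i, (i < n)%N -> defd (s i) theta) ->
  defd e (fun i => evale (s i) theta) -> defd (subst e s) theta.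
Proof.
move=> + ds; elim: e => //= [i|e1 IH1 e2 IH2|e1 IH1 e2 IH2|e1 IH1].
- by move=> /ds.
- by move=> /andP[v1 v2] /andP[d1 d2]; rewrite IH1// IH2.
- by move=> /andP[v1 v2] /andP[d1 d2]; rewrite IH1// IH2.
- by move=> v1 /andP[d1]; rewrite evale_subst => ->; rewrite IH1.
Qed.

Lemma vbound_subst n m e s : vbound n e ->
  (forall i, (i < n)%N -> vbound m (s i)) -> vbound m (subst e s).
Proof.
move=> + vs; elim: e => //= [e1 IH1 e2 IH2|e1 IH1 e2 IH2].
- by move=> /andP[/IH1-> /IH2->].
- by move=> /andP[/IH1-> /IH2->].
Qed.

Lemma defd_De e theta : defd e theta -> defd (De e) theta.
Proof.
elim: e => //= [[]//|e1 IH1 e2 IH2|e1 IH1 e2 IH2|e1 IH1].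
- by move=> /andP[/IH1-> /IH2->].
- move=> /andP[d1 d2]; by rewrite (IH1 d1) (IH2 d2) d1 d2.
- by move=> /andP[d1 ->]; rewrite (IH1 d1) d1.
Qed.

Section NumDen.
Variables (A : comNzRingType) (c : R -> A) (s : nat -> A).

Fixpoint numden e : A * A :=
  match e with
  | Cst r => (c r, 1)
  | Var i => (s i, 1)
  | Add e1 e2 => let: (n1, d1) := numden e1 in let: (n2, d2) := numden e2 in
                 (n1 * d2 + n2 * d1, d1 * d2)
  | Mul e1 e2 => let: (n1, d1) := numden e1 in let: (n2, d2) := numden e2 in
                 (n1 * n2, d1 * d2)
  (* [d * d / (n * d)] rather than [d / n], so that it is undefined when [d] vanishes *)
  | Inv e1 => let: (n1, d1) := numden e1 in (d1 * d1, n1 * d1)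
  end.

Variable h : {rmorphism A -> R}.
Hypothesis hc : forall r, h (c r) = r.

(** The ring [A] is abstract for the sake of two uses: univariate polynomials, when an expression is
    restricted to a line, and polynomials in the invariants, when an expression becomes a quotient P
    / Q. *)
Lemma numdenP e :
  ((h (numden e).2 != 0) = defd e (h \o s)) /\
  (defd e (h \o s) -> h (numden e).1 = evale e (h \o s) * h (numden e).2).
Proof.
elim: e => [r|i|e1 [D1 N1] e2 [D2 N2]|e1 [D1 N1] e2 [D2 N2]|e1 [D1 N1]] /=.
- by rewrite rmorph1 oner_eq0 hc mulr1.
- by rewrite rmorph1 oner_eq0 mulr1.
- case: (numden e1) (numden e2) D1 N1 D2 N2 => n1 d1 [n2 d2]/= <- N1 <- N2.
  rewrite rmorphM/= mulf_eq0 negb_or; split=> // /andP[/N1 N1' /N2 N2'].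
  by rewrite rmorphD !rmorphM/= N1' N2'; ring.
- case: (numden e1) (numden e2) D1 N1 D2 N2 => n1 d1 [n2 d2]/= <- N1 <- N2.
  rewrite rmorphM/= mulf_eq0 negb_or; split=> // /andP[/N1 N1' /N2 N2'].
  by rewrite rmorphM/= N1' N2'; ring.
- case: (numden e1) D1 N1 => n1 d1/= <- N1.
  rewrite !rmorphM/= mulf_eq0 negb_or; split.
    have [//|d0] := eqVneq (h d1) 0; first by rewrite andbF.
    by rewrite N1//= mulf_eq0 (negbTE d0) orbF andbT.
  by move=> /andP[d0 e0]; rewrite N1//; field; rewrite e0.
Qed.

Lemma numden_defd e : (h (numden e).2 != 0) = defd e (h \o s).
Proof. by have [] := numdenP e. Qed.

Lemma numden_evale e : defd e (h \o s) ->
  evale e (h \o s) = h (numden e).1 / h (numden e).2.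
Proof.
move=> de; have [_ /(_ de) ->] := numdenP e.
by rewrite mulfK// numden_defd.
Qed.

End NumDen.

(** * Generic points *)

Lemma poly_pos_avoid (p q : {poly R}) :
  0 < p.[0] -> q != 0 -> exists t, 0 < p.[t] /\ q.[t] != 0.
Proof.
move=> p0 q0.
have : \forall t \near (0 : R), 0 < p.[t].
  have /cvgr_gt /(_ _ p0) : p.[t] @[t --> (0 : R)] --> p.[0].
    exact: continuous_horner.
  by apply: filterS.
move=> /nbhs_ballP[r /= r0 rp].
(* The denominators start at 2 to keep every [T i] strictly inside the ball of radius [r]. *)
pose T i : R := r / i.+2%:R.
have Tr i : 0 < p.[T i].
  apply: rp; rewrite /ball/= sub0r normrN ger0_norm ?divr_ge0 ?ler0n// 1?ltW//.
  by rewrite ltr_pdivrMr ?ltr0n// ltr_pMr// ltr1n.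
apply: contrapT => /forallNP H; move/eqP: q0; apply.
apply: (roots_geq_poly_eq0 (rs := [seq T i | i <- iota 0 (size q)])).
- apply/allP => _ /mapP[i _ ->]; apply/negPn/negP => qT.
  by apply: (H (T i)); split.
- rewrite map_inj_uniq ?iota_uniq// => i j /(mulfI (lt0r_neq0 r0)) /invr_inj.
  by move=> /(mulrIn (oner_neq0 _)) [].
- by rewrite size_map size_iota.
Qed.

(** On the line from [theta0] to [theta1] both expressions become quotients of univariate
    polynomials. Positivity of [q] persists near [theta0], and the denominator of [e] is not the
    zero polynomial because [e] is defined at [theta1]. *)
Lemma generic_pos q e theta0 theta1 :
  defd q theta0 -> 0 < evale q theta0 -> defd e theta1 ->
  exists theta, [/\ defd q theta, 0 < evale q theta & defd e theta].
Proof.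
move=> dq q0 de.
pose l i : {poly R} := (theta0 i)%:P + (theta1 i - theta0 i) *: 'X.
pose F := numden polyC l.
have hc (t r : R) : (r%:P).[t] = r by rewrite hornerC.
have F2 e' t : ((F e').2.[t] != 0) = defd e' (fun i => (l i).[t]).
  exact: (@numden_defd _ polyC l (horner_eval t) (hc t) e').
have Fv e' t : defd e' (fun i => (l i).[t]) ->
    evale e' (fun i => (l i).[t]) = (F e').1.[t] / (F e').2.[t].
  exact: (@numden_evale _ polyC l (horner_eval t) (hc t) e').
have l0 : (fun i => (l i).[0]) = theta0.
  by apply/funext => i; rewrite /l hornerD hornerC hornerZ hornerX mulr0 addr0.
have l1 : (fun i => (l i).[1]) = theta1.
  by apply/funext => i; rewrite /l hornerD hornerC hornerZ hornerX; ring.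
(* A quotient n / d has the sign of the polynomial n d. *)
have sgn t : defd q (fun i => (l i).[t]) ->
    (0 < evale q (fun i => (l i).[t])) = (0 < ((F q).1 * (F q).2).[t]).
  move=> d; rewrite Fv// hornerM.
  have d0 : (F q).2.[t] != 0 by rewrite F2.
  have d2 : 0 < (F q).2.[t] ^+ 2 by rewrite lt_neqAle sqr_ge0 eq_sym expf_neq0.
  by rewrite -(pmulr_lgt0 _ d2); congr (0 < _); field.
have p0 : 0 < ((F q).1 * (F q).2).[0] by rewrite -sgn l0.
have e0 : (F e).2 != 0.
  apply/eqP => e0; have := F2 e 1; rewrite l1 de e0 horner0 eqxx.
  by [].
have [t [pt et]] := poly_pos_avoid p0 e0.
have dqt : defd q (fun i => (l i).[t]).
  rewrite -F2; apply: contraTneq pt => d0.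
  by rewrite hornerM d0 mulr0 ltxx.
by exists (fun i => (l i).[t]); split=> //; rewrite ?sgn// -F2.
Qed.

Lemma generic2 e1 e2 theta1 theta2 : defd e1 theta1 -> defd e2 theta2 ->
  exists theta, defd e1 theta && defd e2 theta.
Proof.
(* [q] is the constant 1 on the domain of [e1], so positivity adds no condition. *)
move=> d1 d2; pose q := Add (Cst 1) (Mul (Cst 0) e1).
have q1 theta : evale q theta = 1 by rewrite /= mul0r addr0.
have [||theta [dq _ de]] := @generic_pos q e2 theta1 theta2 _ _ d2.
- by rewrite /= d1.
- by rewrite q1.
by exists theta; rewrite de andbT; move: dq.
Qed.

End Expressions.

(** * Contact curves and the prolonged affine action *)

Section ContactCurves.
Variable R : realType.
Implicit Types (e : jexpr R) (theta : nat -> R) (c : R -> nat -> R).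

Definition contact theta i : R := evale (De (Var i)) theta.

(* The velocity of c at t0 is kappa times the Cartan vector field D_x. *)
Definition contact_curve c (t0 kappa : R) : Prop :=
  forall i, is_derive t0 (1 : R) (fun t => c t i) (kappa * contact (c t0) i).

Lemma is_derive_unique (V W : normedModType R) (f : V -> W) a v df df' :
  is_derive a v f df -> is_derive a v f df' -> df = df'.
Proof. by move=> [_ <-] [_ <-]. Qed.

Lemma is_derive_continuous (f : R -> R) (t l : R) :
  is_derive t (1 : R) f l -> {for t, continuous f}.
Proof. by move=> [/derivable1_diffP df _]; exact: differentiable_continuous. Qed.

Lemma near_neq0 (f : R -> R) (t : R) :
  {for t, continuous f} -> f t != 0 -> \forall s \near t, f s != 0.
Proof. by move=> fc ft; exact: cvgr_neq0 fc ft. Qed.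

Lemma is_derive_comp (f g : R -> R) (t df dg : R) :
  is_derive t (1 : R) f df -> is_derive (f t) (1 : R) g dg ->
  is_derive t (1 : R) (fun s => g (f s)) (dg * df).
Proof.
move=> [f1 f2] [g1 g2].
have Df := f1; have Dg := g1; move: Df Dg => /derivable1_diffP Df /derivable1_diffP Dg.
apply: DeriveDef; first exact/derivable1_diffP/differentiable_comp.
by rewrite -derive1E derive1_comp// !derive1E f2 g2.
Qed.

Lemma is_derive_mul (f g : R -> R) (t df dg : R) :
  is_derive t (1 : R) f df -> is_derive t (1 : R) g dg ->
  is_derive t (1 : R) (fun s => f s * g s) (df * g t + f t * dg).
Proof.
move=> Df Dg.
have -> : (fun s => f s * g s) = f * g by apply/funext.
by apply: is_derive_eq; rewrite /GRing.scale/= addrC (mulrC df).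
Qed.

Lemma is_derive_evale c t0 kappa e : contact_curve c t0 kappa ->
  defd e (c t0) ->
  is_derive t0 (1 : R) (fun t => evale e (c t)) (kappa * evale (De e) (c t0)).
Proof.
move=> cc; elim: e => [r|i|e1 IH1 e2 IH2|e1 IH1 e2 IH2|e1 IH1] de.
- by rewrite /= mulr0; exact: is_derive_cst.
- exact: cc.
- move: de => /= /andP[/IH1 d1 /IH2 d2].
  by rewrite mulrDr; exact: is_deriveD.
- move: de => /= /andP[/IH1 d1 /IH2 d2].
  by apply: (is_derive_eq (is_derive_mul d1 d2)); rewrite /=; ring.
- move: de => /= /andP[/IH1 d1 e0].
  have [D1 D2] := d1; apply: DeriveDef; first exact: derivableV.
  rewrite deriveV// D2 /GRing.scale/=; move: e0.
  by move=> x0; field.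
Qed.

Lemma near_defd c t0 kappa e : contact_curve c t0 kappa ->
  defd e (c t0) -> \forall t \near t0, defd e (c t).
Proof.
move=> cc; elim: e => [r|i|e1 IH1 e2 IH2|e1 IH1 e2 IH2|e1 IH1] /=.
- by move=> _; apply: filterE.
- by move=> _; apply: filterE.
- by move=> /andP[/IH1 d1 /IH2 d2]; apply: filterS2 d1 d2 => t -> ->.
- by move=> /andP[/IH1 d1 /IH2 d2]; apply: filterS2 d1 d2 => t -> ->.
- move=> /andP[d1 e0].
  have := near_neq0 (is_derive_continuous (is_derive_evale cc d1)) e0.
  by apply: filterS2 (IH1 d1) => t -> ->.
Qed.

(** A straight line, tangent to D_x at time 0. Tangency at this single time is enough to
    differentiate there, and no function with a prescribed infinite jet has to be built. *)
Definition contact_line theta (t : R) i : R := theta i + t * contact theta i.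

Lemma contact_line0 theta : contact_line theta 0 = theta.
Proof. by apply/funext => i; rewrite /contact_line mul0r addr0. Qed.

Lemma contact_curve_line theta : contact_curve (contact_line theta) 0 1.
Proof.
move=> i; rewrite contact_line0 mul1r /contact_line.
have D := is_deriveD (is_derive_cst (theta i) (0 : R) (1 : R)) (is_derive_mul
  (is_derive_id (0 : R) (1 : R)) (is_derive_cst (contact theta i) (0 : R) (1 : R))).
by apply: (is_derive_eq D); rewrite mulr0 mul1r addr0 add0r.
Qed.

(** [De] acts on syntax. Expressions that agree on the open set [defd d] nevertheless have equal
    total derivatives there, both being the derivative of one function along the contact line. *)
Lemma De_eq d e e' theta :
  (forall theta', defd d theta' -> evale e theta' = evale e' theta') ->
  defd d theta -> defd e theta -> defd e' theta ->
  evale (De e) theta = evale (De e') theta.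
Proof.
move=> E dd de de'; rewrite -[LHS]mul1r -[RHS]mul1r.
have cc := contact_curve_line theta.
have h f : defd f theta ->
    is_derive (0 : R) 1 (fun t => evale f (contact_line theta t)) (1 * evale (De f) theta).
  by move=> df; rewrite -{2}(contact_line0 theta); apply: is_derive_evale; rewrite ?contact_line0.
apply: (is_derive_unique (h e de)); apply: near_eq_is_derive (h e' de').
have := near_defd cc (e := d); rewrite contact_line0 => /(_ dd).
by apply: filterS => t /E.
Qed.

End ContactCurves.

(** * Affine maps acting on jets *)

Section AffineAction.
Variable R : realType.
Implicit Types (e : jexpr R) (theta : nat -> R) (c : R -> nat -> R).

(* (x, y) |-> (ca x + cb y + ce, cc x + cd y + cf) *)
Record affine2 := Affine2 { ca : R; cb : R; cc : R; cd : R; ce : R; cf : R }.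
Implicit Types p q : affine2.

Definition adet p := ca p * cd p - cb p * cc p.

(* D_x of the first component of p *)
Definition deltaE p : jexpr R := Cst (ca p) \+e Cst (cb p) \*e Var 2.
Definition delta p theta := evale (deltaE p) theta.

(** The classical recursion y'_(l+1) = D_x y'_l / D_x x'. *)
Fixpoint actE p i : jexpr R :=
  match i with
  | 0 => Cst (ca p) \*e Var 0 \+e Cst (cb p) \*e Var 1 \+e Cst (ce p)
  | 1 => Cst (cc p) \*e Var 0 \+e Cst (cd p) \*e Var 1 \+e Cst (cf p)
  | l.+1 => De (actE p l) \*e Inv (deltaE p)
  end.

Definition act p theta i := evale (actE p i) theta.

Lemma defd_actE p theta i : delta p theta != 0 -> defd (actE p i) theta.
Proof.
by move=> d0; elim: i => [//|[//|i] IH] /=; rewrite defd_De//= d0.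
Qed.

Lemma vbound_actE p i n : (1 < n)%N -> (i < n)%N -> vbound n (actE p i).
Proof.
move=> n1 il.
have: vbound (maxn 2 i.+1) (actE p i).
  elim: i {il} => [//|[//|i] IH]; rewrite [actE _ _]/= -/(actE p i.+1).
  rewrite (maxn_idPr _)// in IH; rewrite (maxn_idPr _)//.
  have -> n' e e' : vbound n' (e \*e Inv e') = vbound n' e && vbound n' e' by [].
  by rewrite vbound_De.
by apply: vbound_le; rewrite geq_max n1.
Qed.

Lemma act_De p theta i : delta p theta != 0 ->
  evale (De (actE p i)) theta = delta p theta * contact (act p theta) i.
Proof.
move=> d0; case: i => [|i]; first by rewrite /delta /contact /=; ring.
rewrite /contact [evale (De (Var i.+1)) _]/= /act [actE p i.+2]/= -/(actE p i.+1).
have -> a b : evale (a \*e Inv b) theta = evale a theta / evale b theta by [].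
by rewrite -/(delta p theta); field.
Qed.

(** The action rescales D_x by delta. On variables this is the recursion of [actE]; both sides obey
    the same sum, product and inverse rules. *)
Lemma De_subst_act p theta e : delta p theta != 0 ->
  evale (De (subst e (actE p))) theta = delta p theta * evale (De e) (act p theta).
Proof.
move=> d0; elim: e => [r|i|e1 IH1 e2 IH2|e1 IH1 e2 IH2|e1 IH1].
- by rewrite /= mulr0.
- exact: act_De.
- by rewrite /= IH1 IH2 mulrDr.
- by rewrite /= IH1 IH2 !evale_subst -/(act p theta); ring.
- by rewrite /= IH1 !evale_subst -/(act p theta); ring.
Qed.

Lemma defd_subst_act p theta e : delta p theta != 0 ->
  defd e (act p theta) -> defd (subst e (actE p)) theta.
Proof.
move=> d0; have [n vn] : exists n, vbound n e.
  elim: e {d0} => [r|i|e1 [n1 v1] e2 [n2 v2]|e1 [n1 v1] e2 [n2 v2]|e1 [n1 v1]].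
  - by exists 0.
  - by exists i.+1 => /=.
  - exists (maxn n1 n2) => /=.
    by rewrite (vbound_le _ v1) ?leq_maxl// (vbound_le _ v2) ?leq_maxr.
  - exists (maxn n1 n2) => /=.
    by rewrite (vbound_le _ v1) ?leq_maxl// (vbound_le _ v2) ?leq_maxr.
  - by exists n1.
by apply: (defd_substW vn) => i _; exact: defd_actE.
Qed.

Definition acomp q p := Affine2
  (ca q * ca p + cb q * cc p) (ca q * cb p + cb q * cd p)
  (cc q * ca p + cd q * cc p) (cc q * cb p + cd q * cd p)
  (ca q * ce p + cb q * cf p + ce q) (cc q * ce p + cd q * cf p + cf q).

Lemma adet_comp q p : adet (acomp q p) = adet q * adet p.
Proof. by rewrite /adet /=; ring. Qed.

Lemma delta_comp q p theta : delta p theta != 0 ->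
  delta (acomp q p) theta = delta q (act p theta) * delta p theta.
Proof. by rewrite /delta /act /= => d0; field. Qed.

(** Induction on the order: the next coordinate is on either side a total derivative divided by
    delta, and [De_subst_act] together with [delta_comp] matches the two quotients. *)
Lemma act_comp q p theta : delta p theta != 0 -> delta q (act p theta) != 0 ->
  act q (act p theta) = act (acomp q p) theta.
Proof.
move=> dp dq; apply/funext => i; elim: i theta dp dq => [|[|i] IH] theta dp dq.
- by rewrite /act /=; ring.
- by rewrite /act /=; ring.
have dqp : delta (acomp q p) theta != 0 by rewrite delta_comp// mulf_neq0.
have step r th : delta r th != 0 ->
    act r th i.+2 = evale (De (actE r i.+1)) th / delta r th by [].
rewrite !step//; apply: (canRL (mulfK dqp)).
rewrite delta_comp// mulrA mulfVK//.
rewrite mulrC -De_subst_act//.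
(* The domain of [d] is an open set on which the induction hypothesis holds, so that the latter can
   be differentiated. *)
pose d := Inv (deltaE p) \+e subst (Inv (deltaE q)) (actE p).
have dE th : defd d th = (delta p th != 0) && defd (subst (Inv (deltaE q)) (actE p)) th.
  by [].
apply: (@De_eq _ d) => [theta'|||].
- rewrite dE => /andP[dp' /defd_subst dq']; rewrite evale_subst.
  exact: (IH theta' dp' dq').
- by rewrite dE dp; exact: defd_subst_act.
- by apply: defd_subst_act => //; exact: defd_actE.
- exact: defd_actE.
Qed.

Definition aid := Affine2 1 0 0 1 0 0.

Lemma act_id theta : act aid theta = theta.
Proof.
have d1 th : delta aid th = 1 by rewrite /delta /= mul0r addr0.
apply/funext => i; elim: i theta => [|[|i] IH] theta.
- by rewrite /act /=; ring.
- by rewrite /act /=; ring.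
have -> : act aid theta i.+2 = evale (De (actE aid i.+1)) theta / delta aid theta by [].
rewrite d1 divr1 (@De_eq _ (Cst 0) _ (Var i.+1))// ?defd_actE// ?d1 ?oner_eq0//.
by move=> theta' _; exact: IH.
Qed.

Definition ainv p := let D := adet p in Affine2
  (cd p / D) (- cb p / D) (- cc p / D) (ca p / D)
  ((cb p * cf p - cd p * ce p) / D) ((cc p * ce p - ca p * cf p) / D).

Lemma adet_inv p : adet p != 0 -> adet (ainv p) = (adet p)^-1.
Proof.
by case: p => a b c d e f; rewrite /ainv /adet /= => D; field.
Qed.

Lemma acompV p : adet p != 0 -> acomp (ainv p) p = aid.
Proof.
case: p => a b c d e f; rewrite /acomp /ainv /adet /= => D.
by congr Affine2; field.
Qed.

Lemma ainvK p : adet p != 0 -> ainv (ainv p) = p.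
Proof.
case: p => a b c d e f; rewrite /ainv /adet /= => D.
by congr Affine2; field; rewrite D.
Qed.

Lemma delta_inv p theta : adet p != 0 -> delta p theta != 0 ->
  delta (ainv p) (act p theta) = (delta p theta)^-1.
Proof.
move=> D d0; apply: (mulIf d0).
rewrite -delta_comp// acompV// mulVf//.
by rewrite /delta /= mul0r addr0.
Qed.

Lemma actK p theta : adet p != 0 -> delta p theta != 0 ->
  act (ainv p) (act p theta) = theta.
Proof.
move=> D d0; rewrite act_comp// ?acompV// ?act_id//.
by rewrite delta_inv// invr_neq0.
Qed.

Lemma delta_neq0 p : adet p != 0 -> exists theta, delta p theta != 0.
Proof.
move=> D; have [a0|a0] := eqVneq (ca p) 0; last first.
  by exists (fun=> 0); rewrite /delta /= mulr0 addr0.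
exists (fun=> 1); rewrite /delta /= a0 mulr1 add0r.
by apply: contraNneq D => b0; rewrite /adet a0 b0 !mul0r subrr.
Qed.

End AffineAction.

(** * Prolongation through curves *)

Section Prolongation.
Variable R : realType.
Implicit Types (theta : nat -> R) (p : affine2 R) (phi psi : R -> R).

Definition affmap p (v : @plane R) : plane :=
  pt (ca p * xcoord v + cb p * ycoord v + ce p)
     (cc p * xcoord v + cd p * ycoord v + cf p).

Lemma xcoord_pt (x y : R) : xcoord (pt x y) = x.
Proof. by rewrite /xcoord mxE. Qed.

Lemma ycoord_pt (x y : R) : ycoord (pt x y) = y.
Proof. by rewrite /ycoord mxE. Qed.

Lemma affmap_pt p phi t :
  affmap p (pt t (phi t)) = pt (act p (jet phi t) 0) (act p (jet phi t) 1).
Proof. by rewrite /affmap xcoord_pt ycoord_pt. Qed.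

Lemma contact_curve_jet phi (t : R) : (forall n, derivable (derive1n n phi) t 1) ->
  contact_curve (jet phi) t 1.
Proof.
move=> Dphi [|l]; rewrite mul1r /contact/=; first exact: is_derive_id.
by apply: DeriveDef; [exact: Dphi|rewrite derive1E].
Qed.

(* Differentiating [y' = psi x'] along the jet of a curve *)
Lemma prolong_step p phi psi (t l : R) e :
  contact_curve (jet phi) t 1 -> defd e (jet phi t) ->
  (\forall u \near t, psi (act p (jet phi u) 0) = evale e (jet phi u)) ->
  is_derive (act p (jet phi t) 0) (1 : R) psi l ->
  evale (De e) (jet phi t) = l * delta p (jet phi t).
Proof.
move=> cphi de E Dpsi.
have D0 := is_derive_evale cphi (isT : defd (actE p 0) (jet phi t)).
have D1 := is_derive_comp D0 Dpsi.
have := is_derive_unique (near_eq_is_derive E D1) (is_derive_evale cphi de).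
by rewrite !mul1r => <-; congr (_ * _); rewrite /delta/=; ring.
Qed.

(** Along the curve y' = psi(x') holds near the base point; differentiating it repeatedly yields the
    recursion of [act]. *)
Lemma prolongs_act p theta theta' : adet p != 0 ->
  prolongs (affmap p) theta theta' -> delta p theta != 0 /\ theta' = act p theta.
Proof.
move=> D [phi [psi [[sphi jphi] [spsi jpsi] e0 gr]]].
set x := theta 0%N in sphi jphi e0 gr *.
have {sphi} cphi : \forall t \near x, contact_curve (jet phi) t 1.
  by apply: filterS sphi => t; exact: contact_curve_jet.
have sc : {for x, continuous (fun t => act p (jet phi t) 0)}.
  exact: is_derive_continuous
    (is_derive_evale (nbhs_singleton cphi) (isT : defd (actE p 0) (jet phi x))).
have [e00 e01] : theta' 0%N = act p theta 0 /\ theta' 1%N = act p theta 1.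
  split.
    by rewrite -(xcoord_pt (theta' 0%N) (theta' 1%N)) -e0 /affmap xcoord_pt ycoord_pt xcoord_pt.
  by rewrite -(ycoord_pt (theta' 0%N) (theta' 1%N)) -e0 /affmap xcoord_pt ycoord_pt ycoord_pt.
have {}spsi : \forall t \near x, forall n, derivable (derive1n n psi) (act p (jet phi t) 0) 1.
  have : \forall u \near act p (jet phi x) 0, forall n, derivable (derive1n n psi) u 1.
    by rewrite jphi -e00.
  exact: sc.
have {}gr : \forall t \near x, psi (act p (jet phi t) 0) = act p (jet phi t) 1.
  apply: filterS gr => t; rewrite affmap_pt /graph/= xcoord_pt ycoord_pt.
  by move=> ->.
have Dn l t : (forall n, derivable (derive1n n psi) t 1) ->
    is_derive t 1 (derive1n l psi) (derive1n l.+1 psi t).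
  by move=> h; apply: DeriveDef; [exact: h|rewrite derive1nS derive1E].
(* If delta vanished, differentiating y' = psi(x') would give D_x y' = 0 too, and the linear part
   would kill the tangent vector (1, y_1). *)
have d0 : delta p theta != 0.
  apply: contraNneq D => d0.
  have := prolong_step (nbhs_singleton cphi) (isT : defd (actE p 1) (jet phi x)) gr
    (Dn 0 _ (nbhs_singleton spsi)).
  move: d0; rewrite jphi => d0; rewrite d0 mulr0.
  move: d0; rewrite /delta /adet/= => d0 d1; apply/eqP.
  have -> : ca p = - cb p * theta 2%N by rewrite -[LHS]subr0 -d0; ring.
  have -> : cc p = - cd p * theta 2%N by rewrite -[LHS]subr0 -d1; ring.
  by ring.
split=> //.
have dn : \forall t \near x, delta p (jet phi t) != 0.
  apply: near_neq0; last by rewrite jphi.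
  exact: is_derive_continuous
    (is_derive_evale (nbhs_singleton cphi) (isT : defd (deltaE p) (jet phi x))).
(* Stated on a neighbourhood because each induction step differentiates it. *)
have key l : \forall t \near x, derive1n l psi (act p (jet phi t) 0) = act p (jet phi t) l.+1.
  elim: l => [//|l IH].
  near=> t.
  have dt : delta p (jet phi t) != 0 by near: t.
  have ct : contact_curve (jet phi) t 1 by near: t.
  have pt : forall n, derivable (derive1n n psi) (act p (jet phi t) 0) 1 by near: t.
  have Et : \forall u \near t, derive1n l psi (act p (jet phi u) 0) = act p (jet phi u) l.+1.
    by near: t; exact: near_join IH.
  have := prolong_step ct (defd_actE l.+1 dt) Et (Dn l _ pt).
  rewrite act_De// mulrC => /(mulIf dt) <-.
  by rewrite /contact.
apply/funext => -[//|l].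
by rewrite -{1}jpsi/= e00 -{1}jphi (nbhs_singleton (key l)) jphi.
Unshelve. all: by end_near. Qed.

Lemma derive1n_horner n (P : {poly R}) : derive1n n (horner P) = horner (P^`(n)).
Proof.
elim: n => [//|n IH]; rewrite derive1nS IH derivnS.
by apply/funext => t; rewrite derivE.
Qed.

Lemma poly_with_jet theta n : (forall i, (n <= i)%N -> theta i = 0) ->
  exists P : {poly R}, jet (horner P) (theta 0%N) = theta.
Proof.
move=> t0; pose Q := \poly_(l < n) (theta l.+1 / l`!%:R).
exists (Q \Po ('X - (theta 0%N)%:P)).
have Dc l : (Q \Po ('X - (theta 0%N)%:P))^`(l) = Q^`(l) \Po ('X - (theta 0%N)%:P).
  elim: l => [//|l IH]; rewrite !derivnS IH deriv_comp.
  by rewrite derivB derivX derivC subr0 mulr1.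
apply/funext => -[//|l] /=; rewrite derive1n_horner Dc horner_comp hornerD hornerX hornerN hornerC subrr.
rewrite horner_coef0 coef_derivn addn0 ffactnn coef_poly.
case: ltnP => ln; last by rewrite mul0rn t0// ltnW.
by rewrite -[LHS]mulr_natr mulfVK// pnatr_eq0 -lt0n fact_gt0.
Qed.

(** A one-variable inverse function theorem: S' has no zero on a ball around [x], so S is injective
    there by the mean value theorem, and [tau] picks the preimage lying in that ball. *)
Lemma local_inverse_horner (S : {poly R}) (x : R) : S^`().[x] != 0 ->
  exists tau : R -> R, [/\ \forall t \near x, tau S.[t] = t,
    \forall u \near S.[x], S.[tau u] = u &
    \forall u \near S.[x], S^`().[tau u] != 0 /\
      is_derive u (1 : R) tau (S^`().[tau u])^-1].
Proof.
move=> Sx.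
have Sn : \forall t \near x, S^`().[t] != 0.
  by apply: near_neq0 => //; exact: continuous_horner.
have /nbhs_ballP[r /= r0 rS] := Sn.
pose T u := [set t | ball x r t /\ S.[t] = u].
have inj t t' : ball x r t -> ball x r t' -> S.[t] = S.[t'] -> t = t'.
  wlog tt' : t t' / t < t'.
    move=> H bt bt' E; have [tt'|tt'|//] := ltgtP t t'; first exact: H.
    by apply/esym/H.
  move=> bt bt' E.
  have [c ci] := @MVT R (horner S) (fun u => S^`().[u]) t t' tt'
    (fun u _ => is_derive_poly S u) (continuous_subspaceT (@continuous_horner _ S)).
  rewrite E subrr => /esym/eqP; rewrite mulf_eq0 subr_eq0 (gt_eqF tt') orbF.
  move: ci; rewrite in_itv/= => /andP[tc ct'].
  have bc : ball x r c.
    move: bt bt'; rewrite /ball/= !ltr_distlC => /andP[? ?] /andP[? ?].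
    by rewrite (lt_trans _ tc)//= (lt_trans ct').
  by rewrite (negbTE (rS c bc)).
pose tau u := xget x (T u).
have K : \forall t \near x, tau S.[t] = t.
  have : \forall t \near x, ball x r t by exact: nbhsx_ballx.
  apply: filterS => t bt; rewrite /tau.
  have [] := @xgetPex _ x (T S.[t]); first by exists t.
  by move=> b' E; exact: inj.
have cS : {near x, continuous (horner S)}.
  by apply: filterE => t; exact: continuous_horner.
have K' := near_continuous_can_sym cS K.
have ct := near_can_continuous K cS.
exists tau; split=> //.
have good : \forall t \near x, S^`().[t] != 0 /\ is_derive S.[t] (1 : R) tau (S^`().[t])^-1.
  near=> t; split; first by near: t.
  apply: (@is_derive_inverse _ (horner S)).
  - by near: t; exact: near_join K.
  - by near: t; exact: near_join cS.
  - by near: t.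
have : \forall u \near S.[x], S^`().[tau u] != 0 /\
    is_derive S.[tau u] (1 : R) tau (S^`().[tau u])^-1.
  have : nbhs (tau S.[x]) (fun t => S^`().[t] != 0 /\
      is_derive S.[t] (1 : R) tau (S^`().[t])^-1) by rewrite (nbhs_singleton K).
  exact: (nbhs_singleton ct).
by apply: filterS2 K' => u /= ->.
Unshelve. all: by end_near. Qed.

(** A finitely supported jet is the jet of a polynomial [P]. The image of its graph has abscissa
    [S], and the image ordinate composed with the local inverse [tau] of [S] is the function [psi]
    sought. *)
Lemma act_prolongs p theta n : (forall i, (n <= i)%N -> theta i = 0) ->
  delta p theta != 0 -> prolongs (affmap p) theta (act p theta).
Proof.
move=> /poly_with_jet[P jP] d0; set x := theta 0%N in jP.
have sP t m : derivable (derive1n m (horner P)) t 1.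
  by rewrite derive1n_horner; exact: derivable_horner.
have cP t : contact_curve (jet (horner P)) t 1 by exact: contact_curve_jet.
pose S := ca p *: 'X + cb p *: P + (ce p)%:P.
have SE t : S.[t] = act p (jet (horner P) t) 0 by rewrite /S !(hornerD, hornerZ, hornerX, hornerC).
have S'E t : S^`().[t] = delta p (jet (horner P) t).
  rewrite /S !(derivD, derivZ, derivX, derivC, hornerD, hornerZ, hornerX, hornerC) addr0 mulr1.
  by rewrite derivE.
have Sx : S^`().[x] != 0 by rewrite S'E jP.
have [tau [K K' D]] := local_inverse_horner Sx.
pose psi u := act p (jet (horner P) (tau u)) 1.
have good l u : (\forall v \near u, S^`().[tau v] != 0 /\
      is_derive v (1 : R) tau (S^`().[tau v])^-1) ->
    derive1n l psi u = act p (jet (horner P) (tau u)) l.+1 /\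
    is_derive u (1 : R) (derive1n l psi) (act p (jet (horner P) (tau u)) l.+2).
  have step m v : S^`().[tau v] != 0 -> is_derive v (1 : R) tau (S^`().[tau v])^-1 ->
    is_derive v (1 : R) (fun w => act p (jet (horner P) (tau w)) m.+1)
      (act p (jet (horner P) (tau v)) m.+2).
    rewrite S'E => dv Dv.
    have cv : contact_curve (fun w => jet (horner P) (tau w)) v (delta p (jet (horner P) (tau v)))^-1.
      move=> i; rewrite mulrC -{1}[contact _ _]mul1r.
      exact: is_derive_comp Dv (cP _ i).
    have := is_derive_evale cv (defd_actE m.+1 dv).
    by rewrite act_De// mulKf.
  elim: l u => [|l IH] u gu.
    by have [s1 s2] := nbhs_singleton gu; split=> //; exact: step.
  have E : \forall v \near u, derive1n l.+1 psi v = act p (jet (horner P) (tau v)) l.+2.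
    have := near_join gu; apply: filterS => v /IH[_ [_ Dv]].
    by rewrite derive1nS derive1E.
  split; first exact: nbhs_singleton E.
  have [s1 s2] := nbhs_singleton gu.
  apply: near_eq_is_derive (step l.+1 u s1 s2).
  by apply: filterS E => v ->.
have tx : tau S.[x] = x by exact: nbhs_singleton K.
exists (horner P), psi; split.
- by split=> //; apply: filterE => t m; exact: sP.
- have -> : act p theta 0 = S.[x] by rewrite SE jP.
  split.
    have := near_join D; apply: filterS => u gu m.
    by have [_ []] := good m u gu.
  apply/funext => -[|l]; first by rewrite /jet SE jP.
  by rewrite /jet (good l _ D).1 tx jP.
- by rewrite /affmap xcoord_pt ycoord_pt.
- apply: filterS K => t Kt; rewrite affmap_pt /graph/= xcoord_pt ycoord_pt.
  by rewrite /psi -SE Kt.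
Qed.

End Prolongation.

(** * Values of rational functions *)

Section RationalValues.
Variable R : realType.
Implicit Types (theta : nat -> R) (e : jexpr R).

Definition ev k (theta : nat -> R) (p : {mpoly R[k]}) : R := p.@[fun i => theta (val i)].

Local Notation "p %:F" := (@FracField.tofrac _ p).

Definition rval k (f : jetrat R k) theta (v : R) : Prop := jval (Jetfun f) theta v.

Lemma evB k theta : {morph @ev k theta : p q / p - q}.
Proof. exact: mevalB. Qed.

Lemma evM k theta : {morph @ev k theta : p q / p * q}.
Proof. exact: mevalM. Qed.

Lemma evX k theta (p : {mpoly R[k]}) n : ev theta (p ^+ n) = ev theta p ^+ n.
Proof. exact: (rmorphXn (meval _)). Qed.

Lemma ev_neq0 k (p : {mpoly R[k]}) : p != 0 -> exists theta, ev theta p != 0.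
Proof.
move=> /mpoly_neq0_meval[v pv].
exists (fun i => if insub i is Some j then v j else 0).
by rewrite /ev (meval_eq _ (v2 := v))// => i; rewrite valK.
Qed.

Lemma fracE (A : idomainType) (f : {fraction A}) :
  f = (frac (repr f)).1 %:F / (frac (repr f)).2 %:F /\ (frac (repr f)).2 != 0.
Proof.
have d0 : (frac (repr f)).2 != 0 by exact: denom_ratioP.
split=> //; move: d0; rewrite -[in LHS](reprK f); move: (repr f) => x d0.
have h : (\pi_({fraction A}) x)%qT * (x.2)%:F = (x.1)%:F.
  unlock FracField.tofrac; rewrite -[LHS]FracField.pi_mul.
  apply/eqmodP; rewrite /= /FracField.equivf /FracField.mulf /=.
  by rewrite !numden_Ratio ?oner_eq0 ?mulr1 ?mulf_neq0 ?oner_eq0// mulrC.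
by rewrite -h mulfK// tofrac_eq0.
Qed.

Lemma frac_eq (A : idomainType) (a b c d : A) : b != 0 -> d != 0 ->
  (a%:F / b%:F == c%:F / d%:F) = (a * d == c * b).
Proof.
move=> b0 d0; rewrite eqr_div ?tofrac_eq0// -!tofracM tofrac_eq.
by [].
Qed.

Lemma ev_den k theta (d : {mpoly R[k]}) : ev theta d != 0 -> d != 0.
Proof. by apply: contraNneq => ->; rewrite /ev meval0. Qed.

Lemma rvalE k (n d : {mpoly R[k.+2]}) theta : ev theta d != 0 ->
  rval (n%:F / d%:F : jetrat R k) theta (ev theta n / ev theta d).
Proof. by move=> d0; exists n, d. Qed.

Lemma rval_numden k (f : jetrat R k) theta v : rval f theta v ->
  exists n d : {mpoly R[k.+2]},
    [/\ f = n%:F / d%:F, ev theta d != 0 & v = ev theta n / ev theta d].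
Proof. by []. Qed.

Lemma rval_uniq k (f : jetrat R k) theta v w : rval f theta v -> rval f theta w -> v = w.
Proof.
move=> [n [d [/= -> d0 ->]]] [n' [d' [/= /eqP + d0' ->]]].
rewrite frac_eq ?(ev_den d0) ?(ev_den d0')// => /eqP/(congr1 (ev theta)).
by rewrite /ev !mevalM => E; apply/eqP; rewrite eqr_div// E.
Qed.

Lemma rval_tofrac k (p : {mpoly R[k.+2]}) theta :
  rval (p%:F : jetrat R k) theta (ev theta p).
Proof.
by exists p, 1; rewrite tofrac1 divr1 /= meval1 oner_eq0 divr1.
Qed.

Lemma rvalD k (f g : jetrat R k) theta v w :
  rval f theta v -> rval g theta w -> rval (f + g) theta (v + w).
Proof.
move=> [n [d [/= -> d0 ->]]] [n' [d' [/= -> d0' ->]]].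
exists (n * d' + n' * d), (d * d'); split => /=.
- by rewrite addf_div ?tofrac_eq0 ?(ev_den d0) ?(ev_den d0')// tofracD !tofracM.
- by rewrite mevalM mulf_neq0.
- by rewrite addf_div// mevalD !mevalM.
Qed.

Lemma rvalM k (f g : jetrat R k) theta v w :
  rval f theta v -> rval g theta w -> rval (f * g) theta (v * w).
Proof.
move=> [n [d [/= -> d0 ->]]] [n' [d' [/= -> d0' ->]]].
exists (n * n'), (d * d'); split => /=.
- by rewrite mulf_div !tofracM.
- by rewrite mevalM mulf_neq0.
- by rewrite mulf_div !mevalM.
Qed.

Lemma rvalV k (f : jetrat R k) theta v :
  v != 0 -> rval f theta v -> rval f^-1 theta v^-1.
Proof.
move=> v0 [n [d [/= -> d0 E]]]; exists d, n; split => /=.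
- by rewrite invf_div.
- by apply: contraNneq v0 => n0; rewrite E n0 mul0r.
- by rewrite E invf_div.
Qed.

Lemma rval_div k (f g : jetrat R k) theta v w : w != 0 ->
  rval f theta v -> rval g theta w -> rval (f / g) theta (v / w).
Proof. by move=> w0 rf rg; apply: rvalM => //; exact: rvalV. Qed.

Lemma rvalX k (f : jetrat R k) theta v n :
  rval f theta v -> rval (f ^+ n) theta (v ^+ n).
Proof.
move=> fv; elim: n => [|n IH].
  by rewrite !expr0 -tofrac1; have := rval_tofrac (1 : {mpoly R[k.+2]}) theta; rewrite /ev meval1.
by rewrite !exprS; exact: rvalM.
Qed.

Lemma rval0 k theta : rval (0 : jetrat R k) theta 0.
Proof.
by have := rval_tofrac (0 : {mpoly R[k.+2]}) theta; rewrite tofrac0 /ev meval0.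
Qed.

Lemma rval1 k theta : rval (1 : jetrat R k) theta 1.
Proof.
by have := rval_tofrac (1 : {mpoly R[k.+2]}) theta; rewrite tofrac1 /ev meval1.
Qed.

Lemma rvalN k (f : jetrat R k) theta v : rval f theta v -> rval (- f) theta (- v).
Proof.
move=> fv; rewrite -mulN1r -[- v]mulN1r; apply: rvalM => //.
have := rval_tofrac (-1 : {mpoly R[k.+2]}) theta.
by rewrite tofracN tofrac1 /ev mevalN meval1.
Qed.

Lemma rval_sum k (I : Type) (r : seq I) (P : pred I) (F : I -> jetrat R k) (G : I -> R) theta :
  (forall i, P i -> rval (F i) theta (G i)) ->
  rval (\sum_(i <- r | P i) F i) theta (\sum_(i <- r | P i) G i).
Proof.
move=> FG; apply: (big_rec2 (fun f v => rval f theta v)); first exact: rval0.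
by move=> i f v Pi fv; apply: rvalD => //; exact: FG.
Qed.

Lemma rval_prod k (I : Type) (r : seq I) (P : pred I) (F : I -> jetrat R k) (G : I -> R) theta :
  (forall i, P i -> rval (F i) theta (G i)) ->
  rval (\prod_(i <- r | P i) F i) theta (\prod_(i <- r | P i) G i).
Proof.
move=> FG; apply: (big_rec2 (fun f v => rval f theta v)); first exact: rval1.
by move=> i f v Pi fv; apply: rvalM => //; exact: FG.
Qed.

(** * Change of jet order and total derivative of fractions *)

Lemma ev_embpoly k m (p : {mpoly R[k.+2]}) theta : (k <= m)%N ->
  ev theta (embpoly m p) = ev theta p.
Proof.
move=> km; rewrite /ev /embpoly comp_mpoly_meval; apply: meval_eq => i.
by rewrite tnth_mktuple mevalXU/= inordK// (leq_trans (ltn_ord i)).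
Qed.

Lemma embpoly_neq0 k m (p : {mpoly R[k.+2]}) : (k <= m)%N -> p != 0 -> embpoly m p != 0.
Proof. by move=> km /ev_neq0[theta]; rewrite -(ev_embpoly _ _ km); exact: ev_den. Qed.

Lemma embpolyD k m : {morph @embpoly R k m : p q / p + q}.
Proof. by move=> p q; exact: rmorphD. Qed.

Lemma embpolyM k m : {morph @embpoly R k m : p q / p * q}.
Proof. by move=> p q; exact: rmorphM. Qed.

Lemma emb_frac k m (n d : {mpoly R[k.+2]}) : (k <= m)%N -> d != 0 ->
  emb m (n%:F / d%:F) = (embpoly m n)%:F / (embpoly m d)%:F.
Proof.
move=> km d0; rewrite /emb /fracmap.
have [+ d0'] := fracE (n%:F / d%:F); move: d0'; set r := frac _.
move=> d0' /eqP; rewrite frac_eq// => /eqP E; apply/eqP.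
by rewrite frac_eq ?embpoly_neq0// -!embpolyM E.
Qed.

Lemma rval_emb k m (f : jetrat R k) theta v : (k <= m)%N ->
  rval f theta v -> rval (emb m f) theta v.
Proof.
move=> km [n [d [/= -> d0 ->]]].
rewrite emb_frac ?(ev_den d0)// -/(ev theta n) -/(ev theta d).
by rewrite -!(ev_embpoly _ _ km); apply: rvalE; rewrite ev_embpoly.
Qed.

Lemma DpolyD k : {morph @Dpoly R k : p q / p + q}.
Proof.
move=> p q; rewrite /Dpoly mderivD embpolyD.
under eq_bigr do rewrite mderivD embpolyD mulrDr.
by rewrite big_split/= addrACA.
Qed.

Lemma DpolyM k (p q : {mpoly R[k.+2]}) :
  Dpoly (p * q) = Dpoly p * embpoly k.+1 q + embpoly k.+1 p * Dpoly q.
Proof.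
rewrite /Dpoly mderivM embpolyD !embpolyM.
under eq_bigr do rewrite mderivM embpolyD !embpolyM mulrDr mulrA mulrCA.
rewrite big_split/= -mulr_suml -mulr_sumr.
by rewrite mulrDl mulrDr addrACA.
Qed.

Lemma DpolyC k c : Dpoly (c%:MP : {mpoly R[k.+2]}) = 0.
Proof.
rewrite /Dpoly mderivC big1 ?addr0; first exact: rmorph0.
by move=> i _; rewrite mderivC /embpoly comp_mpoly0 mulr0.
Qed.

Lemma ev_DpolyX k (i : 'I_k.+2) theta :
  ev theta (Dpoly 'X_i) = contact theta i.
Proof.
have dX (j : 'I_k.+2) : embpoly k.+1 ('X_i : {mpoly R[k.+2]})^`M(j) = (i == j)%:R.
  rewrite mderivX mnm1E; case: eqVneq => [->|_]; last first.
    by rewrite scale0r /embpoly comp_mpoly0.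
  have -> : (U_(j) - U_(j))%MM = 0%MM :> 'X_{1..k.+2} by apply/mnmP => l; rewrite !mnmE subnn.
  by rewrite scale1r mpolyX0 /embpoly comp_mpoly1.
rewrite /Dpoly dX; under eq_bigr do rewrite dX.
case: (unliftP ord0 i) => [j ->|->] /=.
  rewrite add0r (bigD1 j)//= eqxx mulr1.
  rewrite big1 ?addr0 => [|l lj]; last first.
    by rewrite (inj_eq (lift_inj (h:=ord0))) eq_sym (negbTE lj) mulr0.
  by rewrite /ev mevalXU.
rewrite big1 ?addr0 => [|l _]; last by rewrite mulr0.
by rewrite /ev meval1.
Qed.

Lemma jexpr_of_mpoly k (p : {mpoly R[k.+2]}) : exists e,
  [/\ vbound k.+2 e, forall theta, defd e theta,
      forall theta, evale e theta = ev theta p &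
      forall theta, evale (De e) theta = ev theta (Dpoly p)].
Proof.
pose G (p : {mpoly R[k.+2]}) := exists e,
  [/\ vbound k.+2 e, forall theta, defd e theta,
      forall theta, evale e theta = ev theta p &
      forall theta, evale (De e) theta = ev theta (Dpoly p)].
have GC c : G c%:MP.
  exists (Cst c); split=> // theta; first by rewrite /ev mevalC.
  by rewrite DpolyC /ev meval0.
have GX i : G 'X_i.
  exists (Var (val i)); split=> //= theta; first by rewrite /ev mevalXU.
  by rewrite ev_DpolyX.
have GD q1 q2 : G q1 -> G q2 -> G (q1 + q2).
  move=> [e1 [v1 d1 E1 D1]] [e2 [v2 d2 E2 D2]]; exists (e1 \+e e2).
  split=> /= [|theta|theta|theta]; rewrite ?v1 ?d1 ?v2 ?d2//.
    by rewrite E1 E2 /ev mevalD.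
  by rewrite D1 D2 DpolyD /ev mevalD.
have GM q1 q2 : G q1 -> G q2 -> G (q1 * q2).
  move=> [e1 [v1 d1 E1 D1]] [e2 [v2 d2 E2 D2]]; exists (e1 \*e e2).
  split=> /= [|theta|theta|theta]; rewrite ?v1 ?d1 ?v2 ?d2//.
    by rewrite E1 E2 /ev mevalM.
  by rewrite D1 D2 E1 E2 DpolyM -!(@ev_embpoly k k.+1)// /ev [RHS]mevalD ![in RHS]mevalM.
have G1 : G 1 by rewrite -mpolyC1; exact: GC.
elim/mpolyind: p => [|c m p _ _ Gp]; first by rewrite -mpolyC0; exact: GC.
apply: GD Gp; rewrite -mul_mpolyC; apply: (GM); first exact: GC.
rewrite mpolyXE_id; apply: (big_ind G G1 GM) => i _; elim: (m i) => [|n IH]; first by rewrite expr0.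
by rewrite exprS; exact: GM.
Qed.

(** [Dx] is defined through the representative chosen by [repr]; the quotient rule gives the same
    result for any other fraction. *)
Lemma Dx_frac k (n d : {mpoly R[k.+2]}) : d != 0 ->
  Dx (n%:F / d%:F) =
  (Dpoly n * embpoly k.+1 d - embpoly k.+1 n * Dpoly d)%:F / (embpoly k.+1 d ^+ 2)%:F.
Proof.
move=> d0; rewrite /Dx.
have [+ d0'] := fracE (n%:F / d%:F); move: d0'; set r := frac _.
move: (r.1) (r.2) => n0 dd {r} d0' /eqP; rewrite frac_eq// => /eqP E.
apply/eqP; rewrite frac_eq ?expf_neq0 ?embpoly_neq0//.
have E1 := congr1 (embpoly k.+1) E; rewrite !embpolyM in E1.
have E2 := congr1 (@Dpoly R k) E; rewrite !DpolyM in E2.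
rewrite -subr_eq0; apply/eqP; move: E1 E2.
move: (Dpoly n) (Dpoly d) (Dpoly n0) (Dpoly dd) => Dn Dd Dn0 Ddd.
move: (embpoly k.+1 n) (embpoly k.+1 d) (embpoly k.+1 n0) (embpoly k.+1 dd).
move=> N D N0 D0 /eqP; rewrite -subr_eq0 => /eqP E1 /eqP; rewrite -subr_eq0 => /eqP E2.
(* The cross-multiplied difference is a combination of the relation between the two fractions and of
   its total derivative. *)
transitivity ((Ddd * D + D0 * Dd) * (N * D0 - N0 * D)
  - D0 * D * (Dn * D0 + N * Ddd - (Dn0 * D + N0 * Dd))); first by ring.
by rewrite E1 E2 !mulr0 subrr.
Qed.

(** The expression comes from a fraction whose denominator is nonzero at [theta], so it depends on
    the point as well as on [f]. *)
Lemma rval_jexpr k (f : jetrat R k) theta v : rval f theta v -> exists e,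
  [/\ vbound k.+2 e, defd e theta, evale e theta = v &
      forall theta', defd e theta' ->
        rval f theta' (evale e theta') /\ rval (Dx f) theta' (evale (De e) theta')].
Proof.
move=> /rval_numden[n [d [-> d0 ->]]].
have [en [vn dn En Dn]] := jexpr_of_mpoly n.
have [ed [vd dd Ed Dd]] := jexpr_of_mpoly d.
exists (en \*e Inv ed); split=> /=; first by rewrite vn.
- by rewrite dn dd Ed.
- by rewrite En Ed.
move=> theta' /andP[_ /andP[_]]; rewrite !Ed En Dn Dd => d0'.
split; first exact: rvalE.
rewrite Dx_frac ?(ev_den d0')//.
have d0'' : ev theta' (embpoly k.+1 d ^+ 2) != 0.
  by rewrite evX; apply: expf_neq0; rewrite ev_embpoly.
have := rvalE (Dpoly n * embpoly k.+1 d - embpoly k.+1 n * Dpoly d) d0''.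
rewrite evB !evM ?evX !ev_embpoly//.
by move=> h; apply: (eq_ind _ (rval _ theta') h); field.
Qed.

Lemma jexpr_of_rat k (f : jetrat R k) : exists e,
  [/\ vbound k.+2 e, exists theta, defd e theta &
      forall theta', defd e theta' -> rval f theta' (evale e theta')].
Proof.
have [fE /ev_neq0[theta d0]] := fracE f.
have := rvalE (frac (repr f)).1 d0; rewrite -fE => /rval_jexpr[e [ve de _ He]].
by exists e; split=> // [|theta' /He[]//]; exists theta.
Qed.

(** If f - g were nonzero, its numerator would be a nonzero polynomial, hence nonzero somewhere on
    the open set where [q] is positive and [e] is defined. *)
Lemma rat_eq k (f g : jetrat R k) q e theta0 theta1 :
  defd q theta0 -> 0 < evale q theta0 -> defd e theta1 ->
  (forall theta, defd q theta -> 0 < evale q theta -> defd e theta ->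
    exists v, rval f theta v /\ rval g theta v) -> f = g.
Proof.
move=> dq q0 de H; apply/eqP; rewrite -subr_eq0.
have [fE d0] := fracE (f - g); move: fE d0.
set n := (frac _).1; set d := (frac _).2 => fE d0; rewrite fE mulf_eq0 invr_eq0.
rewrite !tofrac_eq0 (negbTE d0) orbF; apply/negPn/negP => n0.
have [theta2] := ev_neq0 (mulf_neq0 n0 d0).
rewrite evM mulf_eq0 negb_or => /andP[nt dt].
have [en [_ dn En _]] := jexpr_of_mpoly n.
have [ed [_ dd Ed _]] := jexpr_of_mpoly d.
(* Only the domain of this expression matters: neither [n] nor [d] vanishes on it. *)
have d1 : defd (Inv en \+e Inv ed) theta2 by rewrite /= dn dd En Ed nt dt.
have [theta3 d13] := generic2 de d1.
have [theta [dq' q0']] := generic_pos dq q0 (d13 : defd (e \+e (Inv en \+e Inv ed)) theta3).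
rewrite /= dn dd En Ed /= => /andP[de' /andP[nt' dt']].
have [v [fv gv]] := H theta dq' q0' de'.
have := rvalD fv (rvalN gv); rewrite fE subrr => /(rval_uniq (rvalE n dt')).
by move/eqP; rewrite mulf_eq0 invr_eq0 (negbTE nt') (negbTE dt').
Qed.

Implicit Types f g : jetfun R.

Definition jrep f e := forall theta, defd e theta -> jval f theta (evale e theta).

Lemma jval_uniq f theta v w : jval f theta v -> jval f theta w -> v = w.
Proof. by case: f => k f; exact: rval_uniq. Qed.

Lemma jval_jexpr f theta v : jval f theta v -> exists e,
  [/\ vbound (jorder f).+2 e, defd e theta, evale e theta = v & jrep f e].
Proof.
case: f => k f /rval_jexpr[e [ve de ev He]]; exists e; split=> //.
by move=> theta' /He[].
Qed.

Lemma jexpr_of_jetfun f : exists e,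
  [/\ vbound (jorder f).+2 e, exists theta, defd e theta & jrep f e].
Proof. by case: f => k f; exact: jexpr_of_rat. Qed.

Lemma rval_Dx f e theta : jrep f e -> defd e theta ->
  rval (Dx (jfun f)) theta (evale (De e) theta).
Proof.
case: f => k f fe de; have [e' [_ de' _ He']] := rval_jexpr (fe _ de).
rewrite (@De_eq _ (e \+e e') e e' theta)//=; last by rewrite de.
- by have [] := He' _ de'.
- move=> theta' /andP[d1 d2]; have [h _] := He' _ d2.
  exact: rval_uniq (fe _ d1) h.
Qed.

Lemma rval_jat f m theta v : (jorder f <= m)%N -> jval f theta v -> rval (jat m f) theta v.
Proof. by case: f => k f km; exact: rval_emb. Qed.

Lemma jval_jmul f g theta v w : jval f theta v -> jval g theta w ->
  jval (jmul f g) theta (v * w).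
Proof.
move=> fv gw; apply: rvalM; apply: rval_jat => //; [exact: leq_maxl|exact: leq_maxr].
Qed.

Lemma jval_jdiv f g theta v w : w != 0 -> jval f theta v -> jval g theta w ->
  jval (jdiv f g) theta (v / w).
Proof.
move=> w0 fv gw; apply: rval_div => //; apply: rval_jat => //;
  [exact: leq_maxl|exact: leq_maxr].
Qed.

Lemma jval_jexp f theta v n : jval f theta v -> jval (jexp f n) theta (v ^+ n).
Proof. by case: f => k f; exact: rvalX. Qed.

Lemma jval_derivation c f theta v e : jval c theta v -> jrep f e -> defd e theta ->
  jval (jetderivation c f) theta (v * evale (De e) theta).
Proof. by move=> cv fe de; apply: jval_jmul => //; exact: rval_Dx. Qed.

Lemma jval_trunc f theta theta' v :
  (forall i, (i < (jorder f).+2)%N -> theta i = theta' i) -> jval f theta v -> jval f theta' v.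
Proof.
move=> E [n [d [/= fE d0 ->]]].
have evE (p : {mpoly R[(jorder f).+2]}) : ev theta p = ev theta' p.
  by apply: meval_eq => i; apply: E; exact: ltn_ord.
have En := evE n; have Ed := evE d; rewrite /ev in En Ed.
by exists n, d; rewrite /= -En -Ed.
Qed.

Lemma rval_evalnabla I nabla m N (P : {mpoly R[N]}) theta (v : nat -> R) :
  nabla_order_le I nabla m N ->
  (forall j, (j < N)%N -> jval (nablaI I nabla j) theta (v j)) ->
  rval (evalnabla I nabla m P) theta (P.@[fun j => v (val j)]).
Proof.
move=> le Iv; rewrite /evalnabla /mmap mevalE; apply: rval_sum => mm _.
apply: rvalM.
  by have := rval_tofrac (P@_mm)%:MP_[m.+2] theta; rewrite /ev mevalC.
apply: rval_prod => j _; apply: rvalX; apply: rval_jat; first exact: le.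
exact: Iv.
Qed.

End RationalValues.

(** * Pull-backs and invariance *)

Section Pullbacks.
Variable R : realType.
Implicit Types (theta : nat -> R) (e : jexpr R) (p : affine2 R) (f h : jetfun R).

(** A linear map scales [omega] by its determinant, so a map of positive determinant, divided by the
    square root of the latter, is symplectic. *)
Lemma ACSp2P (g : plane -> plane) :
  ACSp2 g <-> exists p, 0 < adet p /\ g = @affmap R p.
Proof.
have om u v (A : 'M[R]_2) : omega (A *m u) (A *m v) =
    (A 0 0 * A 1 1 - A 0 1 * A 1 0) * omega u v.
  rewrite /omega /xcoord /ycoord !mxE !big_ord_recl !big_ord0 !addr0.
  have -> : lift ord0 ord0 = 1 :> 'I_2 by apply/val_inj.
  by ring.
have ord2 (i : 'I_2) : i = 0 \/ i = 1.
  by case: i => -[|[|//]] ?; [left|right]; exact/val_inj.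
split=> [[A [b [[S [l [SS l0 ->]]] ->]]]|[p [D ->]]].
  have S1 : S 0 0 * S 1 1 - S 0 1 * S 1 0 = 1.
    have := SS (pt 1 0) (pt 0 1); rewrite om.
    have -> : omega (pt (1 : R) 0) (pt 0 1) = 1.
      by rewrite /omega !xcoord_pt !ycoord_pt; ring.
    by rewrite mulr1.
  exists (Affine2 (l * S 0 0) (l * S 0 1) (l * S 1 0) (l * S 1 1) (b 0 0) (b 1 0)).
  split.
    have -> : adet (Affine2 (l * S 0 0) (l * S 0 1) (l * S 1 0) (l * S 1 1) (b 0 0) (b 1 0))
      = l ^+ 2 * (S 0 0 * S 1 1 - S 0 1 * S 1 0) by rewrite /adet/=; ring.
    by rewrite S1 mulr1 exprn_gt0.
  apply/funext => v; apply/matrixP => i j; rewrite (ord1 j) {j}.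
  rewrite /affmap /xcoord /ycoord !mxE !big_ord_recl !big_ord0 !addr0 !mxE.
  have -> : lift ord0 ord0 = 1 :> 'I_2 by apply/val_inj.
  by case: (ord2 i) => ->.
pose A : 'M[R]_2 := \matrix_(i, j)
  (if i == 0 then (if j == 0 then ca p else cb p) else (if j == 0 then cc p else cd p)).
pose l := Num.sqrt (adet p).
have l0 : 0 < l by rewrite sqrtr_gt0.
have ll : l * l = adet p by rewrite -expr2 sqr_sqrtr// ltW.
exists A, (pt (ce p) (cf p)); split.
  exists (l^-1 *: A), l; split=> //; last by rewrite scalerA mulfV ?scale1r// gt_eqF.
  move=> u v; rewrite om !mxE/=.
  have -> : l^-1 * ca p * (l^-1 * cd p) - l^-1 * cb p * (l^-1 * cc p) = adet p / (l * l).
    by rewrite /adet; field; rewrite gt_eqF.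
  by rewrite ll mulfV ?mul1r// gt_eqF.
apply/funext => v; apply/matrixP => i j; rewrite (ord1 j) {j}.
rewrite /affmap /xcoord /ycoord !mxE !big_ord_recl !big_ord0 !addr0 !mxE.
have -> : lift ord0 ord0 = 1 :> 'I_2 by apply/val_inj.
by case: (ord2 i) => ->.
Qed.

(* The relation is_pullback without curves: the jet of the image curve is act p theta. *)
Definition pulls p f h := forall theta v v',
  delta p theta != 0 -> jval h theta v -> jval f (act p theta) v' -> v = v'.

(** [f] and [h] involve finitely many coordinates, so a jet may be truncated; the truncation is the
    jet of a polynomial, to which [act_prolongs] applies. *)
Lemma is_pullbackP p f h : adet p != 0 -> is_pullback (affmap p) f h <-> pulls p f h.
Proof.
move=> D; split=> [H theta v v' d0 hv fv|H theta theta' v v' /(prolongs_act D)[d0 ->]];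
  last exact: H.
pose n := maxn (jorder h).+2 (jorder f).+2.
pose t i := if (i < n)%N then theta i else 0.
have n3 : (1 < n)%N by rewrite leq_max.
have tE i : (i < n)%N -> theta i = t i by rewrite /t => ->.
have d0t : delta p (fun i => if (i < n.+2)%N then theta i else 0) = delta p theta.
  by rewrite /delta /= ltnS ltnW.
pose s i := if (i < n.+2)%N then theta i else 0.
have sE i : (i < n.+2)%N -> theta i = s i by rewrite /s => ->.
have aE i : (i < n)%N -> act p theta i = act p s i.
  move=> il; apply: (@eq_evale _ n.+2); last exact: sE.
  by apply: vbound_actE => //; rewrite ltnW// ltnS ltnW.
apply: (H s (act p s)).
- apply: (@act_prolongs _ _ _ n.+2); last by rewrite d0t.
  by move=> i ni; rewrite /s ltnNge ni.
- apply: jval_trunc hv => i ih; apply: sE.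
  by rewrite (leq_trans ih)// (leq_trans (leq_maxl _ _ : (_ <= n)%N))// leqW.
- apply: jval_trunc fv => i ih; apply: aE.
  by rewrite (leq_trans ih)// leq_maxr.
Qed.

(** If the two values differed at a jet, the inverse [ee] of their difference would be defined
    there, hence also at some jet in the domain of [e], where they agree. *)
Lemma pulls_generic p f h e theta0 : delta p theta0 != 0 -> defd e theta0 ->
  (forall theta, delta p theta != 0 -> defd e theta ->
    exists v, jval h theta v /\ jval f (act p theta) v) ->
  pulls p f h.
Proof.
move=> d0 de H theta v v' dt /jval_jexpr[eh [_ dh <- Hh]] /jval_jexpr[ef [_ df <- Hf]].
apply/eqP; rewrite -subr_eq0; apply/negPn/negP => ne.
pose ee := Inv (eh \+e Cst (-1) \*e subst ef (actE p)).
have dee : defd ee theta.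
  rewrite /= dh (defd_subst_act dt df)/= evale_subst mulN1r; exact: ne.
have dde : defd (e \+e Inv (deltaE p)) theta0 by rewrite /= de -[_ != 0]/(delta p theta0 != 0) d0.
have [t /andP[/= ht /andP[et dpt]]] := generic2 dee dde.
have [u [hu fu]] := H t dpt et.
case/andP: ht => /andP[dht /defd_subst dft].
rewrite evale_subst -(jval_uniq hu (Hh _ dht)) -(jval_uniq fu (Hf _ dft)).
by rewrite mulN1r subrr eqxx.
Qed.

Lemma defd_act_preim p e theta' : adet p != 0 -> defd e theta' ->
  exists theta, delta p theta != 0 /\ defd e (act p theta).
Proof.
move=> D de.
have D' : adet (ainv p) != 0 by rewrite adet_inv// invr_eq0.
have [t0 dt0] := delta_neq0 D'.
have [t /andP[et dt]] := generic2 de (dt0 : defd (Inv (deltaE (ainv p))) t0).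
have {}dt : delta (ainv p) t != 0 by [].
exists (act (ainv p) t); rewrite -{1 3}(ainvK D) actK//; split=> //.
by rewrite delta_inv// invr_eq0.
Qed.

End Pullbacks.

(** * Weights of y_2, N and M *)

Section Weights.
Variable R : realType.
Implicit Types (theta : nat -> R) (e : jexpr R) (p : affine2 R).

(* y_2^3 I'_4 / y_2^(1/3) *)
Definition NE : jexpr R :=
  Cst 3 \*e Var 3 \*e Var 5 \+e Cst (-5) \*e (Var 4 \*e Var 4).
(* 3 y_2 D_x N - 8 y_3 N *)
Definition ME : jexpr R :=
  Cst 9 \*e (Var 3 \*e Var 3) \*e Var 6 \+e Cst (-45) \*e (Var 3 \*e Var 4 \*e Var 5)
  \+e Cst 40 \*e (Var 4 \*e Var 4 \*e Var 4).
Definition WE : jexpr R := Var 3 \*e NE \*e ME.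
Definition yN theta := evale NE theta.
Definition yM theta := evale ME theta.
Definition generic_jet theta : bool := [&& theta 3%N != 0, yN theta != 0 & yM theta != 0].

Lemma defd_InvWE theta : defd (Inv WE) theta = generic_jet theta.
Proof. by rewrite /= -/(yN theta) -/(yM theta) !mulf_eq0 !negb_or -andbA. Qed.

Lemma yME theta : yM theta = 3 * theta 3%N * evale (De NE) theta - 8 * theta 4%N * yN theta.
Proof. by rewrite /yM /yN /=; ring. Qed.

(** A closed formula for one transformed coordinate is differentiated into the next, without
    expanding the recursion. *)
Lemma act_next p i e theta :
  (forall theta', delta p theta' != 0 -> act p theta' i.+1 = evale e theta') ->
  delta p theta != 0 -> defd e theta ->
  act p theta i.+2 = evale (De e) theta / delta p theta.
Proof.
move=> E d0 de; rewrite /act [actE p i.+2]/= -/(actE p i.+1).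
have -> a b : evale (a \*e Inv b) theta = evale a theta / evale b theta by [].
congr (_ / _); apply: (@De_eq _ (Inv (deltaE p))) => //; last exact: defd_actE.
Qed.

Lemma evaleM e1 e2 theta : evale (e1 \*e e2) theta = evale e1 theta * evale e2 theta.
Proof. by []. Qed.

Lemma defdD e1 e2 theta : defd (e1 \+e e2) theta = defd e1 theta && defd e2 theta.
Proof. by []. Qed.

Lemma evaleV e theta : evale (Inv e) theta = (evale e theta)^-1.
Proof. by []. Qed.

Fixpoint powE e n : jexpr R := if n is n'.+1 then e \*e powE e n' else Cst 1.

Lemma evale_powE e n theta : evale (powE e n) theta = evale e theta ^+ n.
Proof. by elim: n => [//|n IH]; rewrite exprS -IH. Qed.

Lemma defd_powE e n theta : defd e theta -> defd (powE e n) theta.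
Proof. by move=> de; elim: n => [//|n /= ->]; rewrite de. Qed.

Local Notation Id p := (Inv (deltaE p)).

Lemma act_y1 p theta : delta p theta != 0 ->
  act p theta 2 = (cc p + cd p * theta 2%N) / delta p theta.
Proof.
by move=> d0; rewrite /delta /act /= in d0 *; field.
Qed.

Lemma act_y2 p theta : delta p theta != 0 ->
  act p theta 3 = adet p * theta 3%N / delta p theta ^+ 3.
Proof.
move=> d0.
rewrite (@act_next p 1 ((Cst (cc p) \+e Cst (cd p) \*e Var 2) \*e Id p))//=.
- by rewrite /delta /= in d0 *; rewrite /adet; field.
- by move=> t _; rewrite /act /=; ring.
Qed.

Lemma act_y3 p theta : delta p theta != 0 ->
  act p theta 4 = adet p * (theta 4%N * delta p theta - 3 * cb p * theta 3%N ^+ 2)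
    / delta p theta ^+ 5.
Proof.
move=> d0.
rewrite (@act_next p 2 (Cst (adet p) \*e Var 3 \*e Id p \*e Id p \*e Id p))//=.
- by rewrite /delta /= in d0 *; field.
- move=> t dt; rewrite -[LHS]/(act p t 3) act_y2//=.
  by rewrite /delta /= in dt *; field.
- by rewrite d0.
Qed.

Lemma act_y4 p theta : delta p theta != 0 ->
  act p theta 5 = adet p * (theta 5%N * delta p theta ^+ 2
    - 10 * cb p * theta 3%N * theta 4%N * delta p theta
    + 15 * cb p ^+ 2 * theta 3%N ^+ 3) / delta p theta ^+ 7.
Proof.
move=> d0.
rewrite (@act_next p 3 (Cst (adet p) \*e
  (Var 4 \*e deltaE p \+e Cst (- 3 * cb p) \*e (Var 3 \*e Var 3)) \*e powE (Id p) 5))//=.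
- by rewrite /delta /= in d0 *; field.
- move=> t dt; rewrite -[LHS]/(act p t 4) act_y3//=.
  by rewrite /delta /= in dt *; field.
- by rewrite d0.
Qed.

Lemma act_N p theta : delta p theta != 0 ->
  yN (act p theta) = adet p ^+ 2 * yN theta / delta p theta ^+ 8.
Proof.
move=> d0; rewrite /yN /= act_y2// act_y3// act_y4//.
by field.
Qed.

(** M / (y_2 N) is the logarithmic derivative of N^3 / y_2^8, whose weight contains no power of
    delta; hence the terms in D_x delta cancel. *)
Lemma act_M p theta : delta p theta != 0 ->
  yM (act p theta) = adet p ^+ 3 * yM theta / delta p theta ^+ 12.
Proof.
move=> d0.
have DN : delta p theta * evale (De NE) (act p theta) =
    evale (De (Cst (adet p ^+ 2) \*e NE \*e powE (Id p) 8)) theta.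
  rewrite -De_subst_act//; apply: (@De_eq _ (Id p)) => //.
  - move=> t dt; rewrite evale_subst -/(act p t) -/(yN _) act_N//.
    by rewrite -[evale _ t]/(adet p ^+ 2 * yN t * evale (powE (Id p) 8) t) evale_powE exprVn.
  - exact: defd_subst_act.
  - by rewrite /= d0.
rewrite yME act_y2// act_y3// act_N//.
rewrite -[evale (De NE) (act p theta)](mulKf d0) DN yME /yN.
by rewrite /= /delta /= in d0 *; field.
Qed.

Lemma generic_jet_act p theta : adet p != 0 -> delta p theta != 0 ->
  generic_jet (act p theta) = generic_jet theta.
Proof.
move=> D d0; rewrite /generic_jet act_y2// act_N// act_M//.
by rewrite !(mulf_eq0, invr_eq0, expf_eq0) /= (negbTE D) (negbTE d0) /= !orbF.
Qed.

End Weights.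

(** * Invariance of I_5 and of the derivation *)

Section Invariance.
Variable R : realType.
Implicit Types (theta : nat -> R) (e : jexpr R) (p : affine2 R) (f h : jetfun R).

(* y_2 N / M and M^2 / N^3 *)
Definition cE : jexpr R := powE (Var 3 \*e NE R) 2 \*e Inv (WE R).
Definition J0E : jexpr R := powE (ME R) 2 \*e powE (Var 3 \*e ME R) 3 \*e powE (Inv (WE R)) 3.

Lemma cE_val theta : generic_jet theta -> evale cE theta = theta 3%N * yN theta / yM theta.
Proof.
move=> /and3P[y0 n0 m0].
rewrite !(evaleM, evaleV, evale_powE) -/(yN theta) -/(yM theta) /=.
by field; rewrite y0 n0 m0.
Qed.

Lemma J0E_val theta : generic_jet theta -> evale J0E theta = yM theta ^+ 2 / yN theta ^+ 3.
Proof.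
move=> /and3P[y0 n0 m0].
rewrite !(evaleM, evaleV, evale_powE) -/(yN theta) -/(yM theta) /=.
by field; rewrite y0 n0 m0.
Qed.

(** The common denominator y_2 N M was put into [cE] and [J0E] so that both have the generic jets as
    domain. *)
Lemma defd_cE theta : defd cE theta = generic_jet theta.
Proof. by rewrite -defd_InvWE. Qed.

Lemma defd_J0E theta : defd J0E theta = generic_jet theta.
Proof. by rewrite -defd_InvWE /=; case: (_ != 0). Qed.

Lemma jval_coef'' theta : theta 3%N != 0 ->
  jval coef'' theta (yN theta / theta 3%N ^+ 3).
Proof.
move=> y0; exists (3 * 'X_(inord 3) * 'X_(inord 5) - 5 * 'X_(inord 4) ^+ 2),
  ('X_(inord 3) ^+ 3); split; first exact: coef''_frac.
  by rewrite rmorphXn /= mevalXU inordK// expf_neq0.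
rewrite !(rmorphXn, rmorphB, rmorphM, rmorph_nat) /= !mevalXU !inordK//.
by congr (_ / _); rewrite /yN /=; ring.
Qed.

Lemma jval_I4'' theta : theta 3%N != 0 ->
  jval I4'' theta (yN theta ^+ 3 / theta 3%N ^+ 8).
Proof.
move=> y0.
have -> : yN theta ^+ 3 / theta 3%N ^+ 8 = theta 3%N * (yN theta / theta 3%N ^+ 3) ^+ 3.
  by field.
apply: rvalM; last exact: (rvalX 3 (jval_coef'' y0)).
have := rval_tofrac ('X_(inord 3) : {mpoly R[6]}) theta.
by rewrite /ev mevalXU /= inordK.
Qed.

Lemma jval_nabla''I4'' theta : theta 3%N != 0 ->
  jval (nabla'' I4'') theta (yN theta ^+ 3 * yM theta / theta 3%N ^+ 12).
Proof.
move=> y0; pose e := powE (NE R) 3 \*e powE (Inv (Var 3)) 8.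
have re : jrep I4'' e.
  move=> t; rewrite /e evaleM !evale_powE evaleV exprVn -/(yN t).
  by move=> /= /andP[t0 _]; exact: jval_I4''.
have de : defd e theta by rewrite /= y0.
have -> : yN theta ^+ 3 * yM theta / theta 3%N ^+ 12 =
    yN theta / theta 3%N ^+ 3 * evale (De e) theta.
  by rewrite /yN /yM /=; field.
exact: jval_derivation (jval_coef'' y0) re de.
Qed.

Lemma jrep_I5 : jrep I5 J0E.
Proof.
move=> theta; rewrite defd_J0E => gt; rewrite J0E_val//.
have /and3P[y0 n0 m0] := gt.
have -> : yM theta ^+ 2 / yN theta ^+ 3 =
  (yN theta ^+ 3 * yM theta / theta 3%N ^+ 12) ^+ 2 / (yN theta ^+ 3 / theta 3%N ^+ 8) ^+ 3.
  by field; rewrite y0 n0.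
apply: jval_jdiv; first by rewrite expf_neq0// mulf_neq0 ?invr_eq0 ?expf_neq0.
- exact/jval_jexp/jval_nabla''I4''.
- exact/jval_jexp/jval_I4''.
Qed.

Lemma jval_nabla''' f e theta : jrep f e -> defd e theta -> generic_jet theta ->
  jval (nabla''' f) theta (evale cE theta * evale (De e) theta).
Proof.
move=> fe de gt; have /and3P[y0 n0 m0] := gt; apply: jval_derivation => //.
rewrite cE_val//.
have -> : theta 3%N * yN theta / yM theta =
    (yN theta ^+ 3 / theta 3%N ^+ 8) / (yN theta ^+ 3 * yM theta / theta 3%N ^+ 12)
    * (yN theta / theta 3%N ^+ 3) by field; rewrite y0 n0 m0.
apply: jval_jmul; last exact: jval_coef''.
apply: jval_jdiv; last exact: jval_nabla''I4''.
- by rewrite !mulf_neq0 ?invr_eq0 ?expf_neq0.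
- exact: jval_I4''.
Qed.

Lemma generic_jet_ex : exists theta, generic_jet theta.
Proof.
(* Here y_2 = y_4 = y_5 = 1 and y_3 = 0, whence N = 3 and M = 9. *)
exists (fun i => if i == 4 then 0 else 1).
by rewrite /generic_jet /yN /yM /= !(mulr0, addr0, mulr1) oner_eq0 !pnatr_eq0.
Qed.

Lemma cE_act p theta : adet p != 0 -> delta p theta != 0 -> generic_jet theta ->
  evale cE (act p theta) = delta p theta * evale cE theta.
Proof.
move=> D d0 gt; have /and3P[y0 n0 m0] := gt.
rewrite !cE_val ?generic_jet_act// act_y2// act_N// act_M//.
by field; rewrite d0 m0 D.
Qed.

(** Where h = f o p, one has D_x h = delta times (D_x f) o p, and the factor delta is absorbed by
    the weight of the coefficient in [cE_act]. *)
Lemma pulls_nabla p f h : adet p != 0 -> pulls p f h -> pulls p (nabla''' f) (nabla''' h).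
Proof.
move=> D H.
have [ef [_ [t1 df] Hf]] := jexpr_of_jetfun f.
have [eh [_ [t2 dh] Hh]] := jexpr_of_jetfun h.
(* The points up to [t6] serve to find one jet at which all the expressions involved are defined. *)
have [t3 gt3] := generic_jet_ex.
have [t4 [dp4 df4]] := defd_act_preim D df.
pose e1 := subst ef (actE p) \+e Inv (deltaE p).
have d1 : defd e1 t4 by rewrite /e1 /= defd_subst_act//=; exact: dp4.
pose e2 := eh \+e Inv (WE R).
have [t5 d2] : exists t, defd e2 t.
  by have := generic2 dh (_ : defd (Inv (WE R)) t3); rewrite defd_InvWE => /(_ gt3).
have [t6 /andP[d1' d2']] := generic2 d1 d2.
have dp6 : delta p t6 != 0 by case/andP: d1' => _ /andP[].
apply: (@pulls_generic _ p _ _ (e1 \+e e2) t6) => //; first by rewrite defdD d1'.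
move=> t dpt; rewrite !defdD defd_InvWE => /andP[/andP[dft _] /andP[dht gt]].
have dft' := defd_subst dft.
exists (evale cE t * evale (De eh) t); split; first exact: jval_nabla'''.
have -> : evale cE t * evale (De eh) t =
    evale cE (act p t) * evale (De ef) (act p t).
  rewrite cE_act// -mulrA mulrCA; congr (_ * _).
  rewrite -De_subst_act//; apply: (@De_eq _ (eh \+e e1)) => //.
    move=> t' /= /andP[dh' /andP[df' dp']]; rewrite evale_subst.
    exact: H (Hh _ dh') (Hf _ (defd_subst df')).
  by rewrite /= dht dft; exact: dpt.
by apply: jval_nabla''' => //; rewrite generic_jet_act.
Qed.

Lemma pulls_I5 p : adet p != 0 -> pulls p I5 I5.
Proof.
move=> D; have [t3 gt3] := generic_jet_ex.
have [t0 dt0] := delta_neq0 D.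
have [t /andP[dt gt]] := generic2 (dt0 : defd (Inv (deltaE p)) t0)
  (etrans (defd_J0E t3) gt3).
apply: (@pulls_generic _ p _ _ J0E t) => // {dt gt}t dt gt.
exists (evale J0E t); split; first exact: jrep_I5.
have := gt; rewrite defd_J0E => gt'; have /and3P[y0 n0 m0] := gt'.
have -> : evale J0E t = evale J0E (act p t).
  rewrite !J0E_val ?generic_jet_act// act_N// act_M//.
  by field; rewrite n0 D dt.
by apply: jrep_I5; rewrite defd_J0E generic_jet_act.
Qed.

Lemma nabla_invariant : invariant_derivation ACSp2 (@nabla''' R).
Proof.
split; first by eexists.
move=> g /ACSp2P[p [D ->]] f h.
have D0 : adet p != 0 by rewrite gt_eqF.
by move=> /is_pullbackP H; apply/is_pullbackP => //; apply: pulls_nabla => //; exact: H.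
Qed.

End Invariance.

(** * The invariants nabla'''^j I_5 *)

Section Tower.
Variable R : realType.
Implicit Types (theta : nat -> R) (e : jexpr R) (p : affine2 R) (f : jetfun R).

Local Notation I5 := (@I5 R).
Local Notation nabla''' := (@nabla''' R).
Local Notation J j := (nablaI I5 nabla''' j).
Local Notation cE := (cE R).
Local Notation NE := (NE R).
Local Notation ME := (ME R).
Local Notation WE := (WE R).

Definition invNE : jexpr R := Var 3 \*e ME \*e Inv WE.

(* D_x M with its leading term 9 y_2^2 y_6 removed *)
Definition DMlow : jexpr R :=
  Cst (-27) \*e (Var 3 \*e Var 4 \*e Var 6) \+e Cst (-45) \*e (Var 3 \*e Var 5 \*e Var 5)
  \+e Cst 75 \*e (Var 4 \*e Var 4 \*e Var 5).

(* nabla'''^(l+1) I_5 = lowE l + leadE l * y_(6+l), where lowE l and leadE l *)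
(* involve no y_i with i >= 6 + l.                                           *)
Fixpoint leadE l : jexpr R :=
  if l is l'.+1 then cE \*e leadE l'
  else Cst 18 \*e powE (Var 3) 3 \*e powE invNE 2.

Fixpoint lowE l : jexpr R :=
  if l is l'.+1 then cE \*e (De (lowE l') \+e De (leadE l') \*e Var (7 + l'))
  else Var 3 \*e (Cst 2 \*e DMlow \*e NE \+e Cst (-3) \*e ME \*e De NE) \*e powE invNE 3.

Definition JE j : jexpr R :=
  if j is l.+1 then lowE l \+e leadE l \*e Var (7 + l) else J0E R.

Lemma defd_invNE theta : defd invNE theta = generic_jet theta.
Proof. by rewrite -defd_InvWE. Qed.

Lemma invNE_val theta : generic_jet theta -> evale invNE theta = (yN theta)^-1.
Proof.
move=> /and3P[y0 n0 m0].
rewrite /invNE /WE !(evaleM, evaleV) -/(yN theta) -/(yM theta) /=.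
by field; rewrite y0 n0 m0.
Qed.

Lemma defd_leadE l theta : generic_jet theta -> defd (leadE l) theta.
Proof.
move=> gt; elim: l => [|l IH]; last first.
  by rewrite -[defd _ _]/(defd cE theta && defd (leadE l) theta) defd_cE gt.
rewrite -[defd _ _]/(defd (powE invNE 2) theta).
by apply: defd_powE; rewrite defd_invNE.
Qed.

Lemma leadE_neq0 l theta : generic_jet theta -> evale (leadE l) theta != 0.
Proof.
move=> gt; have /and3P[y0 n0 m0] := gt; elim: l => [|l IH].
  have -> : evale (leadE 0) theta =
    18 * evale (powE (Var 3) 3) theta * evale (powE invNE 2) theta by [].
  rewrite !evale_powE invNE_val//.
  by rewrite !mulf_neq0// ?expf_neq0// ?invr_eq0//= pnatr_eq0.
by rewrite -[leadE _]/(cE \*e leadE l) evaleM mulf_neq0// cE_val// !mulf_neq0// invr_eq0.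
Qed.

Lemma defd_lowE l theta : generic_jet theta -> defd (lowE l) theta.
Proof.
move=> gt; elim: l => [|l IH]; last first.
  rewrite -[defd _ _]/(defd cE theta && (defd (De (lowE l)) theta &&
    (defd (De (leadE l)) theta && true))) defd_cE gt.
  by rewrite !defd_De// defd_leadE.
rewrite -[defd _ _]/(defd (powE invNE 3) theta).
by apply: defd_powE; rewrite defd_invNE.
Qed.

Lemma defd_JE j theta : defd (JE j) theta = generic_jet theta.
Proof.
case: j => [|l]; first exact: defd_J0E.
apply/idP/idP => [|gt]; last first.
  by rewrite /JE defdD defd_lowE//= defd_leadE.
rewrite /JE defdD => /andP[_].
rewrite -[defd _ _]/(defd (leadE l) theta && true) andbT.
elim: l => [|l IH].
  by rewrite -[defd _ _]/(defd invNE theta && (defd invNE theta && true)) defd_invNE => /andP[].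
by rewrite -[defd _ _]/(defd cE theta && defd (leadE l) theta) => /andP[_].
Qed.

Lemma vbound_leadE l : vbound 7 (leadE l).
Proof. by elim: l => [//|l IH]; rewrite /= IH. Qed.

Lemma vbound_lowE l : vbound (7 + l) (lowE l).
Proof.
elim: l => [//|l IH].
have cb : vbound 7 cE by [].
rewrite -[vbound _ _]/(vbound (7 + l.+1) cE && (vbound (7 + l.+1) (De (lowE l)) &&
  (vbound (7 + l.+1) (De (leadE l)) && (7 + l < 7 + l.+1)%N))).
rewrite (vbound_le _ cb) ?leq_addr// addnS ltnS leqnn andbT vbound_De//=.
have lb : vbound 8 (De (leadE l)) by apply: vbound_De => //; exact: vbound_leadE.
by rewrite (vbound_le _ lb).
Qed.

Lemma vbound_JE j : vbound (7 + j) (JE j).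
Proof.
case: j => [//|l]; rewrite /JE.
rewrite -[vbound _ _]/(vbound (7 + l.+1) (lowE l) && (vbound (7 + l.+1) (leadE l) &&
  (7 + l < 7 + l.+1)%N)).
rewrite (vbound_le _ (vbound_lowE l)) ?leq_add2l//.
by rewrite (vbound_le _ (vbound_leadE l)) ?leq_addr// ltn_add2l ltnSn.
Qed.

(** Start of the recursion: nabla''' (M^2 / N^3) = y_2 (2 N D_x M - 3 M D_x N) / N^3, where the
    leading term of D_x M contributes 18 y_2^3 y_6 / N^2. *)
Lemma cE_De_J0E theta : generic_jet theta ->
  evale cE theta * evale (De (J0E R)) theta = evale (JE 1) theta.
Proof.
move=> gt; have /and3P[y0 n0 m0] := gt.
pose e := ME \*e ME \*e Inv (NE \*e NE \*e NE).
have -> : evale (De (J0E R)) theta = evale (De e) theta.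
  apply: (@De_eq _ (Inv WE)); rewrite ?defd_InvWE ?defd_J0E//.
    move=> t; rewrite defd_InvWE => gt'; rewrite J0E_val// /e.
    rewrite !(evaleM, evaleV) -/(yN t) -/(yM t).
    by have /and3P[_ n0' _] := gt'; field.
  by rewrite -[defd _ _]/(yN theta * yN theta * yN theta != 0) !mulf_neq0.
have DeM e1 e2 : evale (De (e1 \*e e2)) theta =
    evale (De e1) theta * evale e2 theta + evale e1 theta * evale (De e2) theta by [].
have DeV e1 : evale (De (Inv e1)) theta =
    -1 * evale (De e1) theta * ((evale e1 theta)^-1 * (evale e1 theta)^-1) by [].
have DME : evale (De ME) theta = evale DMlow theta + 9 * theta 3%N ^+ 2 * theta 7%N.
  by rewrite /=; ring.
rewrite cE_val// /e !(DeM, DeV, evaleM, evaleV) DME.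
have -> : evale (JE 1) theta = theta 3%N * (2 * evale DMlow theta * evale NE theta
    + -3 * evale ME theta * evale (De NE) theta) * evale (powE invNE 3) theta
    + 18 * evale (powE (Var 3) 3) theta * evale (powE invNE 2) theta * theta 7%N by [].
rewrite !evale_powE invNE_val// -/(yN theta) -/(yM theta).
move: (evale DMlow theta) (evale (De NE) theta) => a b.
by rewrite /=; field; rewrite n0 m0.
Qed.

Lemma jrep_J j : jrep (J j) (JE j).
Proof.
have Jstep j' theta : jrep (J j') (JE j') -> generic_jet theta ->
    jval (J j'.+1) theta (evale cE theta * evale (De (JE j')) theta).
  by move=> IH gt; apply: jval_nabla''' => //; rewrite defd_JE.
elim: j => [|j IH]; first exact: jrep_I5.
move=> theta; rewrite defd_JE => gt; have := Jstep j theta IH gt.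
case: j {IH} => [|l]; first by rewrite cE_De_J0E.
suff -> : evale cE theta * evale (De (JE l.+1)) theta = evale (JE l.+2) theta by [].
(* By the product rule the term in y_(7+l) is the new leading one; the others go to [lowE]. *)
have -> : evale (De (JE l.+1)) theta = evale (De (lowE l)) theta +
  (evale (De (leadE l)) theta * theta (7 + l)%N + evale (leadE l) theta * theta (7 + l.+1)%N).
  by rewrite addnS.
have -> : evale (JE l.+2) theta = evale cE theta * (evale (De (lowE l)) theta +
  evale (De (leadE l)) theta * theta (7 + l)%N) + evale cE theta * evale (leadE l) theta * theta (7 + l.+1)%N.
  by [].
by ring.
Qed.

Lemma pulls_J p j : adet p != 0 -> pulls p (J j) (J j).
Proof.
by move=> D; elim: j => [|j IH]; [exact: pulls_I5|exact: pulls_nabla].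
Qed.

(** * The slice of normal jets and its coordinates *)

Definition Jvals theta j : R := evale (JE j) theta.

Lemma Jvals_act p theta : adet p != 0 -> delta p theta != 0 -> generic_jet theta ->
  Jvals (act p theta) = Jvals theta.
Proof.
move=> D d0 gt; apply/funext => j; apply/esym.
apply: (@pulls_J p j D _ _ _ d0); first by apply: jrep_J; rewrite defd_JE.
by apply: jrep_J; rewrite defd_JE generic_jet_act.
Qed.

(* Every jet with y_2 <> 0 and M N > 0 has a jet (0, 0, 0, 1, 0, tau, tau, y_6, ...)
   in its orbit. *)
Definition normal theta : Prop :=
  [/\ theta 0%N = 0, theta 1%N = 0 & theta 2%N = 0] /\
  [/\ theta 3%N = 1, theta 4%N = 0, theta 5%N = theta 6%N & theta 6%N != 0].

Lemma normal_NM theta : normal theta -> yN theta = 3 * theta 6%N /\ yM theta = 9 * theta 6%N.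
Proof. by move=> [_ [t3 t4 t5 _]]; rewrite /yN /yM /= t3 t4 t5; split; ring. Qed.

Lemma normal_generic theta : normal theta -> generic_jet theta.
Proof.
move=> nt; have [EN EM] := normal_NM nt; have [_ [t3 _ _ t6]] := nt.
by rewrite /generic_jet EN EM t3 oner_eq0 !mulf_neq0// pnatr_eq0.
Qed.

Lemma normal_J0 theta : normal theta -> Jvals theta 0 = 3 / theta 6%N.
Proof.
move=> nt; have [EN EM] := normal_NM nt; have [_ [_ _ _ t6]] := nt.
by rewrite /Jvals J0E_val ?normal_generic// EN EM; field.
Qed.

(** The translation moves the base point to the origin, y'_1 = 0 fixes [c], y'_3 = 0 fixes [b], and
    y'_2 = 1 makes the determinant dl^3 / y_2. It then has the sign of M N. *)
Lemma normalize theta : theta 3%N != 0 -> 0 < yN theta * yM theta ->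
  exists p, [/\ 0 < adet p, delta p theta != 0 & normal (act p theta)].
Proof.
move=> y0 NM.
have n0 : yN theta != 0 by apply: contraTneq NM => ->; rewrite mul0r ltxx.
have m0 : yM theta != 0 by apply: contraTneq NM => ->; rewrite mulr0 ltxx.
pose y1 := theta 2%N; pose y2 := theta 3%N; pose y3 := theta 4%N.
(* On the image N' = 3 y'_4 and M' = 9 y'_5, so y'_4 = y'_5 amounts to M' = 3 N'; the weights turn
   this into an equation for [dl]. *)
pose dl := yM theta / (3 * yN theta * y2).
have dl0 : dl != 0 by rewrite /dl !mulf_neq0 ?invr_eq0 ?mulf_neq0 ?pnatr_eq0.
pose d := dl ^+ 2 / y2; pose b := y3 * dl / (3 * y2 ^+ 2).
pose a := dl - b * y1; pose c := - d * y1.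
pose p := Affine2 a b c d (- (a * theta 0%N + b * theta 1%N)) (- (c * theta 0%N + d * theta 1%N)).
have pd : delta p theta = dl by rewrite /delta /= /a -/y1; ring.
have pD : adet p = dl ^+ 3 / y2 by rewrite /adet /= /a /c /d; field.
have d0 : delta p theta != 0 by rewrite pd.
have a3 : act p theta 3 = 1.
  by rewrite act_y2// pd pD -/y2; field; rewrite y0 dl0.
have a4 : act p theta 4 = 0.
  by rewrite act_y3// pd pD -/y2 -/y3 /= /b; field; rewrite y0 dl0.
have a5 : act p theta 5 = yN (act p theta) / 3 by rewrite /yN /= a3 a4; field.
have a6 : act p theta 6 = yM (act p theta) / 9 by rewrite /yM /= a3 a4; field.
exists p; split=> //.
  rewrite pD.
  have -> : dl ^+ 3 / y2 = dl ^+ 2 / (3 * (yN theta * y2) ^+ 2) * (yN theta * yM theta).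
    by rewrite /dl; field; rewrite n0 y0.
  rewrite mulr_gt0// divr_gt0//; first by rewrite exprn_even_gt0.
  by rewrite mulr_gt0// exprn_even_gt0//= mulf_neq0.
split; split => //.
- by rewrite /act /=; ring.
- by rewrite /act /=; ring.
- by rewrite act_y1//= /c mulNr addNr mul0r.
- rewrite a5 a6 act_N// act_M// pd pD /dl; field.
  by rewrite n0 m0 y0.
- rewrite a6 act_M// pd pD; move: (dl) dl0 => z z0.
  rewrite !(mulf_eq0, invr_eq0, expf_eq0) (negbTE z0) (negbTE m0).
  by rewrite (negbTE y0) pnatr_eq0.
Qed.

(* [sig l i] expresses the i-th coordinate (i < 7 + l) of a normal jet through its *)
(* values Var j of nabla'''^j I_5, j <= l.                                         *)
Fixpoint sig l (i : nat) : jexpr R :=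
  if l is l'.+1 then
    if i == (7 + l')%N
    then (Var l'.+1 \+e Cst (-1) \*e subst (lowE l') (sig l')) \*e Inv (subst (leadE l') (sig l'))
    else sig l' i
  else match i with
       | 3 => Cst 1
       | 5 | 6 => Cst 3 \*e Inv (Var 0)
       | _ => Cst 0
       end.

Definition slice l (v : nat -> R) i : R := evale (sig l i) v.

Lemma sig_next l i : (i < 7 + l)%N -> sig l.+1 i = sig l i.
Proof. by move=> il; rewrite /= ltn_eqF. Qed.

Lemma vbound_sig l i : (i < 7 + l)%N -> vbound l.+1 (sig l i).
Proof.
elim: l i => [|l IH] i il; first by move: i il; do 7?[case=> //].
move: il; rewrite addnS ltnS leq_eqVlt => /orP[/eqP->|il]; last first.
  by rewrite sig_next//; apply: vbound_le (IH _ il).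
rewrite [sig _ _]/= eqxx.
rewrite -[vbound _ _]/((l.+1 < l.+2)%N && vbound l.+2 (subst (lowE l) (sig l))
   && vbound l.+2 (subst (leadE l) (sig l))).
have IH' i0 : (i0 < 7 + l)%N -> vbound l.+2 (sig l i0).
  by move=> /IH; exact: vbound_le.
rewrite ltnSn (vbound_subst (vbound_lowE l) IH')/=.
by apply: (vbound_subst (vbound_leadE l)) => j j7; apply: IH'; rewrite (leq_trans j7)// leq_addr.
Qed.

(** Each step solves an affine equation for the top coordinate; its leading coefficient is nonzero
    on generic jets. *)
Lemma slice_normal l theta i : normal theta -> (i < 7 + l)%N ->
  defd (sig l i) (Jvals theta) /\ slice l (Jvals theta) i = theta i.
Proof.
move=> nt; have gt := normal_generic nt.
have [[t0 t1 t2] [t3 t4 t5 t6]] := nt.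
have J0 := normal_J0 nt.
have J0n : Jvals theta 0 != 0 by rewrite J0 mulf_neq0 ?invr_eq0// pnatr_eq0.
have tau : 3 / Jvals theta 0 = theta 6%N by rewrite J0; field.
elim: l i => [|l IH] i il.
  by move: i il; do 7?[case]; rewrite // /slice /= ?tau ?J0n ?t5.
move: il; rewrite addnS ltnS leq_eqVlt => /orP[/eqP->|il]; last first.
  by rewrite /slice sig_next//; exact: IH.
have IHd i0 : (i0 < 7 + l)%N -> defd (sig l i0) (Jvals theta) by move=> /IH[].
have IHv i0 : (i0 < 7 + l)%N -> theta i0 = slice l (Jvals theta) i0.
  by move=> /IH[].
have b7 : vbound (7 + l) (leadE l).
  by apply: vbound_le (vbound_leadE l); rewrite leq_addr.
have dlow : defd (subst (lowE l) (sig l)) (Jvals theta).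
  apply: (defd_substW (vbound_lowE l) IHd).
  by rewrite -(eq_defd (vbound_lowE l) IHv) defd_lowE.
have dlead : defd (subst (leadE l) (sig l)) (Jvals theta).
  by apply: (defd_substW b7 IHd); rewrite -(eq_defd b7 IHv) defd_leadE.
have vlow : evale (subst (lowE l) (sig l)) (Jvals theta) = evale (lowE l) theta.
  by rewrite evale_subst -(eq_evale (vbound_lowE l) IHv).
have vlead : evale (subst (leadE l) (sig l)) (Jvals theta) = evale (leadE l) theta.
  by rewrite evale_subst -(eq_evale b7 IHv).
have l0 := leadE_neq0 l gt.
have Jl : Jvals theta l.+1 = evale (lowE l) theta + evale (leadE l) theta * theta (7 + l)%N by [].
rewrite /slice [sig _ _]/= eqxx; split.
  by rewrite /= dlow dlead vlead l0.
rewrite evaleM evaleV vlead.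
rewrite -[evale _ (Jvals theta)]/(Jvals theta l.+1 + -1 * evale (subst (lowE l) (sig l)) (Jvals theta)).
by rewrite vlow Jl; field.
Qed.

Lemma normal_slice l (v : nat -> R) : v 0%N != 0 -> normal (slice l v).
Proof.
move=> v0.
have base i : (i < 7)%N -> slice l v i = slice 0 v i.
  move=> i7; elim: l => [//|l IH]; rewrite /slice sig_next//.
  by rewrite (leq_trans i7)// leq_addr.
split; split; rewrite ?base//.
by rewrite /slice /= mulf_neq0 ?invr_eq0// pnatr_eq0.
Qed.

(** The converse of [slice_normal]: J_0, ..., J_l take arbitrary values on the slice, subject only
    to J_0 being nonzero. *)
Lemma slice_J l (v : nat -> R) j : v 0%N != 0 -> (j <= l)%N -> Jvals (slice l v) j = v j.
Proof.
move=> v0; elim: l => [|l IH].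
  rewrite leqn0 => /eqP->; rewrite normal_J0; last exact: normal_slice.
  by rewrite /slice /=; field.
have E i : (i < 7 + l)%N -> slice l.+1 v i = slice l v i.
  by move=> il; rewrite /slice sig_next.
rewrite leq_eqVlt => /orP[/eqP->|jl]; last first.
  rewrite -(IH jl); apply: (eq_evale (vbound_JE j)) => i ij; apply: E.
  by rewrite (leq_trans ij)// leq_add2l.
have b7 : vbound (7 + l) (leadE l).
  by apply: vbound_le (vbound_leadE l); rewrite leq_addr.
have l0 := leadE_neq0 l (normal_generic (normal_slice l v0)).
have -> : Jvals (slice l.+1 v) l.+1 = evale (lowE l) (slice l.+1 v) +
  evale (leadE l) (slice l.+1 v) * slice l.+1 v (7 + l)%N by [].
rewrite (eq_evale (vbound_lowE l) E) (eq_evale b7 E).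
rewrite [slice _ _ (7 + l)]/slice [sig _ _]/= eqxx evaleM evaleV.
rewrite -[evale (_ \+e _) v]/(v l.+1 + -1 * evale (subst (lowE l) (sig l)) v).
rewrite !evale_subst -/(slice l v).
by field.
Qed.

(** * Absence of syzygies *)

Lemma no_syzygies_I5 : no_syzygies I5 nabla'''.
Proof.
move=> N P m le E0; apply/eqP/negPn/negP => P0.
have [w Pw wpos] : exists2 w : 'I_N -> R, P.@[w] != 0 & forall i : 'I_N, val i = 0%N -> w i != 0.
  case: N P P0 {le E0} => [|n] P P0.
    by have [w Pw] := mpoly_neq0_meval P0; exists w => // -[].
  have X0 : ('X_ord0 : {mpoly R[n.+1]}) != 0.
    apply/eqP => /(congr1 (meval (fun=> 1 : R))).
    by rewrite mevalXU meval0 => /eqP; rewrite oner_eq0.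
  (* Multiplying [P] by X_0 yields a point where both [P] and the value prescribed for J_0 are
     nonzero. *)
  have [w] := mpoly_neq0_meval (mulf_neq0 P0 X0).
  rewrite mevalM mevalXU mulf_eq0 negb_or => /andP[Pw w0]; exists w => // i i0.
  by have -> : i = ord0 by exact/val_inj.
(* The default 1 keeps [v 0] nonzero when N = 0. *)
pose v i := if insub i is Some j then w j else 1.
have v0 : v 0%N != 0.
  rewrite /v; case: insubP => [i _ i0|_]; first exact: wpos.
  exact: oner_neq0.
have vw (j : 'I_N) : v (val j) = w j by rewrite /v valK.
have := rval_evalnabla P (theta := slice N v) (v := v) le.
rewrite E0 => /(_ _)/rval_uniq/(_ (rval0 _ _)) H.
have : P.@[fun j : 'I_N => v (val j)] = 0.
  apply: H => j jN; rewrite -(slice_J v0 (ltnW jN)).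
  by apply: jrep_J; rewrite defd_JE normal_generic//; exact: normal_slice.
by rewrite (meval_eq _ vw); apply/eqP.
Qed.

(** * Invariants are the rational expressions in the J_j *)

Lemma rat_neq0 k (g : jetrat R k) : g != 0 -> exists e,
  (exists theta, defd e theta) /\
  forall theta, defd e theta -> exists2 v, v != 0 & rval g theta v.
Proof.
move=> g0; have [e1 [_ [t1 d1] H1]] := jexpr_of_rat g.
have [e2 [_ [t2 d2] H2]] := jexpr_of_rat g^-1.
have [t d12] := generic2 d1 d2; exists (e1 \+e e2); split; first by exists t.
move=> theta; rewrite defdD => /andP[/H1 h1 /H2 h2]; exists (evale e1 theta) => //.
have := rvalM h1 h2; rewrite mulfV// => /(rval_uniq (rval1 _ _)) E.
by apply/eqP => z; move: E; rewrite z mul0r => /eqP; rewrite oner_eq0.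
Qed.

(** At a generic jet every J_j has the same value as at the image jet, hence so has the quotient of
    [P] by [Q]; the rest collects a jet where everything is defined. *)
Lemma generated_pulls p f : adet p != 0 -> rationally_generated I5 nabla''' f -> pulls p f f.
Proof.
move=> D [N [P [Q [m [fm le Q0 fE]]]]].
have [ef [_ [t1 df] Hf]] := jexpr_of_jetfun f.
have [eQ [[t2 dQ] HQ]] := rat_neq0 Q0.
have [t3 gt3] := generic_jet_ex R.
have [t4 [dp4 df4]] := defd_act_preim D df.
have d1 : defd (subst ef (actE p) \+e Inv (deltaE p)) t4.
  by rewrite defdD defd_subst_act.
have [t5 d2] := generic2 df (etrans (defd_InvWE t3) gt3).
have [t6 d3] := generic2 d1 dQ.
have [t7 /andP[]] := generic2 (d2 : defd (ef \+e Inv WE) t5)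
  (d3 : defd (subst ef (actE p) \+e Inv (deltaE p) \+e eQ) t6).
rewrite !defdD defd_InvWE => /andP[df7 gt7] /andP[/andP[ds7 dl7] dQ7].
apply: (@pulls_generic _ p _ _ (ef \+e Inv WE \+e subst ef (actE p) \+e eQ) t7) => //.
  by rewrite !defdD defd_InvWE df7 gt7 ds7.
move=> t dt; rewrite !defdD defd_InvWE => /andP[/andP[/andP[dft gt] dst] /HQ[q q0 Qt]].
have Jt j : jval (J j) t (Jvals t j) by apply: jrep_J; rewrite defd_JE.
have Ja j : jval (J j) (act p t) (Jvals t j).
  by rewrite -(Jvals_act D dt gt); apply: jrep_J; rewrite defd_JE generic_jet_act.
have PQ th : (forall j, jval (J j) th (Jvals t j)) ->
    rval (jat m f) th (P.@[fun j => Jvals t (val j)] / Q.@[fun j => Jvals t (val j)]).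
  move=> Jth; rewrite fE; apply: rval_div; try exact: rval_evalnabla.
  have Qv : rval (evalnabla I5 nabla''' m Q) t (Q.@[fun j => Jvals t (val j)]).
    exact: rval_evalnabla.
  by rewrite -(rval_uniq Qt Qv).
exists (evale ef t); split; first exact: Hf.
have -> : evale ef t = evale ef (act p t).
  apply: (rval_uniq (f := jat m f) (theta := t)); first exact/rval_jat/Hf.
  rewrite -(rval_uniq (PQ _ Ja) (rval_jat fm (Hf _ (defd_subst dst)))).
  exact: PQ.
exact/Hf/defd_subst.
Qed.

(** If p normalises t, invariance under r0 p gives f(t) = f(r0 p t). Since p t is the slice jet with
    the values J_j(t), this is an expression [F] in these values. *)
Lemma invariant_generated f : (forall p, 0 < adet p -> pulls p f f) ->
  rationally_generated I5 nabla''' f.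
Proof.
move=> H; have [e [ve [t1 d1] He]] := jexpr_of_jetfun f.
set k := jorder f in ve.
(* Positivity of [q] combines both hypotheses of [normalize]. *)
pose q := NE \*e ME \*e (Var 3 \*e Var 3).
have qP t : 0 < evale q t -> t 3%N != 0 /\ 0 < yN t * yM t.
  have -> : evale q t = yN t * yM t * t 3%N ^+ 2 by [].
  have [->|t0] := eqVneq (t 3%N) 0; first by rewrite expr0n mulr0 ltxx.
  by rewrite pmulr_lgt0// exprn_even_gt0.
have qg t : 0 < evale q t -> generic_jet t.
  by move=> /qP[t0]; rewrite /generic_jet t0 => /lt0r_neq0; rewrite mulf_eq0 negb_or.
have [t0 [_ q0 d0]] : exists t, [/\ defd q t, 0 < evale q t & defd e t].
  (* At [w] one has N = 3 and M = 9, so [q] is 27. *)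
  pose w (i : nat) : R := if i == 4 then 0 else 1.
  have qw : 0 < evale q w by rewrite /q /w /= !(mulr0, addr0, mulr1) mulr_gt0.
  exact: generic_pos (isT : defd q w) qw d1.
have [y0 NM0] := qP _ q0.
have [p0 [D0 dp0 n0]] := normalize y0 NM0.
have D0' : adet p0 != 0 by rewrite gt_eqF.
(* [r0] carries the normal form of [t0] back to [t0], where [e] is defined. So [e] composed with
   [r0] is defined somewhere on the slice, even if [e] is not. *)
pose r0 := ainv p0; pose N := k.+1.
have kN : (k.+2 <= 7 + k)%N by rewrite -addn2 addnC leq_add2r.
have vr : vbound k.+2 (subst e (actE r0)).
  by apply: (vbound_subst ve) => i ik; exact: vbound_actE.
pose F := subst (subst e (actE r0)) (sig k).
have vF : vbound N F.
  by apply: (vbound_subst vr) => i ik; apply: vbound_sig; exact: leq_trans ik kN.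
(* delta involves y_1 alone, which is 0 on the slice, so its value is that at the normal form of
   [t0]. *)
have dr0 t : normal t -> delta r0 t != 0.
  move=> [[_ _ t2] _].
  have -> : delta r0 t = delta r0 (act p0 t0).
    by have [[_ _ n2] _] := n0; rewrite /delta /= t2 n2.
  by rewrite delta_inv// invr_eq0.
have sl t i : normal t -> (i < k.+2)%N -> t i = slice k (Jvals t) i.
  by move=> nt ik; have [] := slice_normal nt (leq_trans ik kN).
have dF t : normal t -> defd F (Jvals t) = defd e (act r0 t).
  move=> nt; apply/idP/idP => [/defd_subst|da].
    rewrite -(eq_defd vr (sl _ ^~ nt)); exact: defd_subst.
  apply: (defd_substW vr) => [i ik|].
    by have [] := slice_normal nt (leq_trans ik kN).
  rewrite -(eq_defd vr (fun i => sl t i nt)); apply: defd_subst_act => //.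
  exact: dr0.
have EF t : normal t -> evale F (Jvals t) = evale e (act r0 t).
  by move=> nt; rewrite evale_subst -(eq_evale vr (fun i => sl t i nt)) evale_subst.
have dF0 : defd F (Jvals t0).
  by rewrite -(Jvals_act D0' dp0 (qg _ q0)) dF// actK.
have key t : 0 < evale q t -> defd e t -> defd F (Jvals t) ->
    jval f t (evale F (Jvals t)).
  move=> qt et; have [yt NMt] := qP _ qt.
  have [p [D dp nt]] := normalize yt NMt.
  have Dp : adet p != 0 by rewrite gt_eqF.
  rewrite -(Jvals_act Dp dp (qg _ qt)) dF// EF// => da.
  have Drp : 0 < adet (acomp r0 p) by rewrite adet_comp adet_inv// mulr_gt0 ?invr_gt0.
  have da0 := dr0 _ nt.
  have drp : delta (acomp r0 p) t != 0 by rewrite delta_comp// mulf_neq0.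
  rewrite -(H _ Drp _ _ _ drp (He _ et) (_ : jval f _ (evale e (act r0 (act p t))))).
    exact: He.
  by rewrite -act_comp//; exact: He.
pose h (t : nat -> R) := meval (fun j : 'I_N => Jvals t (val j)).
(* Denominators are cleared in [F], with its variables standing for the J_j. *)
pose P := (numden (@mpolyC N R) (fun i => 'X_(inord i)) F).1.
pose Q := (numden (@mpolyC N R) (fun i => 'X_(inord i)) F).2.
have hc t r : h t r%:MP = r by exact: mevalC.
have hX t i : (i < N)%N -> Jvals t i = (h t \o (fun i => 'X_(inord i))) i.
  by move=> iN; rewrite /h /= mevalXU /= inordK.
have dQ t : (h t Q != 0) = defd F (Jvals t).
  by rewrite (numden_defd _ (hc t)) -(eq_defd vF (hX t)).
have EPQ t : defd F (Jvals t) -> evale F (Jvals t) = h t P / h t Q.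
  move=> dt; rewrite (eq_evale vF (hX t)); apply: (numden_evale (hc t)).
  by rewrite -(eq_defd vF (hX t)).
pose m := maxn k (\max_(j < N) jorder (J j)).
have le : nabla_order_le I5 nabla''' m N.
  move=> j jN; rewrite /m leq_max; apply/orP; right.
  exact: (leq_bigmax (F := fun j : 'I_N => jorder (J j)) (Ordinal jN)).
have Jt t : 0 < evale q t -> forall j, (j < N)%N -> jval (J j) t (Jvals t j).
  by move=> /qg gt j _; apply: jrep_J; rewrite defd_JE.
exists N, P, Q, m; split=> //; first exact: leq_maxl.
- apply/eqP => Q0; have := rval_evalnabla Q le (Jt _ q0); rewrite Q0.
  by move=> /(rval_uniq (rval0 _ _)) E; move: dF0; rewrite -dQ /h -E eqxx.
(* The formula is known only where [q] is positive; this open set suffices for equality of rational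
   functions. *)
- apply: (@rat_eq _ _ _ _ q (e \+e subst F JE) t0 t0) => //.
    rewrite defdD d0 /=; apply: (defd_substW vF) => // i _.
    by rewrite defd_JE qg.
  move=> t _ qt; rewrite defdD => /andP[et /defd_subst Ft].
  exists (evale F (Jvals t)); split; first by apply: rval_jat; [exact: leq_maxl|exact: key].
  rewrite EPQ//; apply: rval_div; first by rewrite dQ.
    exact: (rval_evalnabla P le (Jt _ qt)).
  exact: (rval_evalnabla Q le (Jt _ qt)).
Qed.

End Tower.

Theorem mainTheorem14 (R : realType) :
  invariant_derivation (@ACSp2 R) (@nabla''' R) /\
  is_free_diff_algebra (diff_invariant (@ACSp2 R)) (@I5 R) (@nabla''' R).
Proof.
split; first exact: nabla_invariant.
split; last exact: no_syzygies_I5.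
move=> f; split=> [Hf|gf g /ACSp2P[p [D ->]]].
  apply: invariant_generated => p D; apply/is_pullbackP; first by rewrite gt_eqF.
  by apply: Hf; apply/ACSp2P; exists p.
have D0 : adet p != 0 by rewrite gt_eqF.
by apply/is_pullbackP => //; exact: generated_pulls.
Qed.
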